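(* Let $\mathcal{C}$ be a small extriangulated category with enough $\mathbb{E}$-injectives, $n\geq0$, and $\mathcal{X}=\mathrm{add}(\mathcal{X})$ an $(n+2)$-rigid subcategory of $\mathcal{C}$ with $\mathcal{I}_{\mathbb{E}}(\mathcal{C})\subseteq\mathcal{X}$. Let $(\mathcal{M}_2,\varepsilon_2):=(\mathcal{X}_{n+1}^{\wedge}/[\mathcal{X}],\varepsilon_{\mathbb{K}})$, which is a weakly idempotent complete exact category, and let $(\varepsilon_2(\mathcal{M}_2),\varepsilon_2)$ be its category of conflations. Then: (a) $\mathcal{S}(\mathcal{M}_2)$ is a pseudo-cluster tilting subcategory in $(\varepsilon_2(\mathcal{M}_2),\varepsilon_2)$. In particular, $\varepsilon_2(\mathcal{M}_2)=\mathcal{S}(\mathcal{M}_2)_1^{\wedge}=\mathcal{S}(\mathcal{M}_2)_1^{\vee}$. (b) The quotient $\varepsilon_2(\mathcal{M}_2)/[\mathcal{S}(\mathcal{M}_2)]$ is an abelian category. (c) $\mathcal{S}(\mathcal{M}_2)$ can be described in terms of the exact duality $\mathbb{K}:\mathcal{M}_2\to\mathcal{L}_{\mathcal{X}}^n$ as follows: for a conflation $\eta:K\overset{[a]}{\rightarrowtail}M\overset{[b]}{\twoheadrightarrow}N$ in $\mathcal{M}_2$, we have $\eta\in\mathcal{S}(\mathcal{M}_2)$ if and only if there exist a split $\mathbb{E}$-triangle $K\xrightarrow{\begin{pmatrix}a\\ f\\ i\end{pmatrix}}M\oplus X\oplus I\xrightarrow{b'}N'\overset{\delta}{\dashrightarrow}$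 in $\mathcal{C}$ with $X\in\mathcal{X}$ and $I\in\mathcal{I}_{\mathbb{E}}(\mathcal{C})$, and an isomorphism between $\mathbb{K}(N')$ and $\mathbb{K}(N)$ in $\mathcal{L}_{\mathcal{X}}^n$ which, together with the identities of $\mathbb{K}(M)$ and $\mathbb{K}(K)$, gives a commutative diagram in $\mathcal{L}_{\mathcal{X}}^n$ between the conflations $\mathbb{K}(N')\overset{\mathbb{K}[b']}{\rightarrowtail}\mathbb{K}(M)\overset{\mathbb{K}[a]}{\twoheadrightarrow}\mathbb{K}(K)$ and $\mathbb{K}(N)\overset{\mathbb{K}[b]}{\rightarrowtail}\mathbb{K}(M)\overset{\mathbb{K}[a]}{\twoheadrightarrow}\mathbb{K}(K)$ (here $\mathbb{K}(M\oplus X\oplus I)$ is identified with $\mathbb{K}(M)$, since $X$ and $I$ are zero in $\mathcal{M}_2$).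
   Context: All classes of objects are regarded as full subcategories. An extriangulated category $(\mathcal{C},\mathbb{E},\mathfrak{s})$ (in the sense of Nakaoka–Palu) is an additive category $\mathcal{C}$ with an additive bifunctor $\mathbb{E}:\mathcal{C}^{op}\times\mathcal{C}\to Ab$ and an additive realization $\mathfrak{s}$, assigning to each $\delta\in\mathbb{E}(C,A)$ an equivalence class of sequences $A\to B\to C$, satisfying (ET3), (ET3)$^{op}$, (ET4), (ET4)$^{op}$. A sequence $A\xrightarrow{x}B\xrightarrow{y}C$ realizing some $\delta\in\mathbb{E}(C,A)$ is a conflation ($x$ is an inflation, $y$ a deflation), and together with $\delta$ it is an $\mathbb{E}$-triangle $A\to B\to C\overset{\delta}{\dashrightarrow}$, split if $\delta=0$. A morphism $f$ is $\mathbb{E}$-projective if $\mathbb{E}(f,-)=0$ (class $\mathcal{P}_{1,\mathbb{E}}(\mathcal{C})$) and $\mathbb{E}$-injective if $\mathbb{E}(-,f)=0$ (class $\mathcal{I}_{1,\mathbb{E}}(\mathcal{C})$). An object $I$ is $\mathbb{E}$-injective (class $\mathcal{I}_{\mathbb{E}}(\mathcal{C})$) if $\mathcal{C}(x,I)$ is surjective for every inflation $x$. $\mathcal{C}$ has enough $\mathbb{E}$-injectives if every object $C$ admits an inflation $C\to I$ with $I\in\mathcal{I}_{\mathbb{E}}(\mathcal{C})$. Higher $\mathbb{E}$-extension groups: a family $\{\mathbb{E}^i\}_{i\geq1}$ of additive bifunctors $\mathcal{C}^{op}\times\mathcal{C}\to Ab$ with $\mathbb{E}^1=\mathbb{E}$;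 for each $\mathbb{E}$-triangle $A\to B\to C\dashrightarrow$ and each $i\geq 1$ there are natural transformations $\mathbb{E}^i(A,-)\to\mathbb{E}^{i+1}(C,-)$ and $\mathbb{E}^i(-,C)\to\mathbb{E}^{i+1}(-,A)$, compatible with morphisms of $\mathbb{E}$-triangles, making $\mathbb{E}^i(C,-)\to\mathbb{E}^i(B,-)\to\mathbb{E}^i(A,-)\to\mathbb{E}^{i+1}(C,-)$ and $\mathbb{E}^i(-,A)\to\mathbb{E}^i(-,B)\to\mathbb{E}^i(-,C)\to\mathbb{E}^{i+1}(-,A)$ exact; and $\mathbb{E}^i(f,-)=0$, $\mathbb{E}^i(-,g)=0$ for all $i\geq1$, $f\in\mathcal{P}_{1,\mathbb{E}}(\mathcal{C})$, $g\in\mathcal{I}_{1,\mathbb{E}}(\mathcal{C})$. Every small extriangulated category has such a family; one is fixed. $\mathcal{X}\subseteq\mathcal{C}$ is $(n+2)$-rigid if $\mathbb{E}^i(X,X')=0$ for all $X,X'\in\mathcal{X}$ and $1\leq i\leq n+1$. $\mathrm{add}(\mathcal{X})$ is the class of direct summands of finite coproducts of objects of $\mathcal{X}$. A finite $\mathcal{X}$-resolution of $C$ of length $m\geq 0$ consists of objects $C=K_0,\dots,K_m$ and $X_0,\dots,X_m\in\mathcal{X}$, conflations $K_{i+1}\to X_i\to K_i$ for $0\leq i<m$, and an isomorphism $K_m\simeq X_m$; finite coresolutions are dual (conflations $K_i\to X_i\to K_{i+1}$). $\mathcal{X}_n^{\wedge}$ (resp. $\mathcal{X}_n^{\vee}$)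 is the class of objects with a finite $\mathcal{X}$-resolution (resp. coresolution) of length $\leq n$. The same notation is used in exact categories. $[\mathcal{X}]$ is the ideal of morphisms factoring through objects of $\mathcal{X}$; $[h]$ is the class of $h$ in the quotient. $\overline{\mathcal{X}_n^{\wedge}}$ is the quotient of $\mathcal{X}_n^{\wedge}$ by the ideal of its morphisms $f$ with $\mathbb{E}(-,f)=0$; $\overline{\mathcal{X}_n^{\wedge}}\,\mathsf{Mod}$ is the category of covariant additive functors $\overline{\mathcal{X}_n^{\wedge}}\to Ab$. $\overline{\mathbb{E}}(M,-)$ is the functor on $\overline{\mathcal{X}_n^{\wedge}}$ induced by $\mathbb{E}(M,-)|_{\mathcal{X}_n^{\wedge}}$, and $\mathbb{K}:\mathcal{X}_{n+1}^{\wedge}/[\mathcal{X}]\to\overline{\mathcal{X}_n^{\wedge}}\,\mathsf{Mod}$, $M\mapsto\overline{\mathbb{E}}(M,-)$, is the induced (fully faithful, contravariant) functor. $\mathcal{L}_{\mathcal{X}}^n\subseteq\overline{\mathcal{X}_n^{\wedge}}\,\mathsf{Mod}$ is the full subcategory of those $G$ with an exact sequence $\overline{\mathcal{X}_n^{\wedge}}(X_0,-)\to\overline{\mathcal{X}_n^{\wedge}}(X_1,-)\to G\to0$, $X_0\in\mathcal{X}$, $X_1\in\mathcal{X}_n^{\wedge}$; it is extension-closed and viewed as an exact category with the induced structure. $\varepsilon_{\mathbb{K}}$ is the class of pairs $A'\to A\to A''$ in $\mathcal{X}_{n+1}^{\wedge}/[\mathcal{X}]$ with $0\to\mathbb{K}(A'')\to\mathbb{K}(A)\to\mathbb{K}(A')\to0$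 exact in $\overline{\mathcal{X}_n^{\wedge}}\,\mathsf{Mod}$. $\mathbb{K}:(\mathcal{X}_{n+1}^{\wedge}/[\mathcal{X}],\varepsilon_{\mathbb{K}})\to\mathcal{L}_{\mathcal{X}}^n$ is a duality of exact categories. An additive category is weakly idempotent complete if every split epimorphism has a kernel. For an exact category $(\mathcal{M},\varepsilon)$, the category of conflations $\varepsilon(\mathcal{M})$ has as objects the conflations $X_1\rightarrowtail X_2\twoheadrightarrow X_3$ of $\mathcal{M}$ and as morphisms the commutative diagrams (triples of morphisms) between them; it has an exact structure computed degree-wise, denoted $(\varepsilon(\mathcal{M}),\varepsilon)$. $\mathcal{S}(\mathcal{M})$ is the class of all split conflations in $\mathcal{M}$. A class $\mathcal{D}\subseteq\mathcal{M}$ is pseudo-cluster tilting in $(\mathcal{M},\varepsilon)$ if $\mathcal{D}=\mathrm{add}(\mathcal{D})$ and for each $M\in\mathcal{M}$ there are conflations $M\xrightarrow{\alpha}D_0\to D_1$ and $D_1'\to D_0'\xrightarrow{\beta}M$ with $D_0,D_1,D_0',D_1'\in\mathcal{D}$, where $\alpha$ is a $\mathcal{D}$-preenvelope (every morphism from $M$ to an object of $\mathcal{D}$ factors through $\alpha$) and $\beta$ is a $\mathcal{D}$-precover (every morphism from an object of $\mathcal{D}$ to $M$ factors through $\beta$). *)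

(* Defs.v *)
From HB Require Import structures.
From mathcomp Require Import all_boot all_algebra.
From mathcomp Require Import generic_quotient ring_quotient.
From mathcomp Require Import boolp.

Set Implicit Arguments.
Unset Strict Implicit.
Unset Printing Implicit Defensive.

Import GRing.Theory.
Local Open Scope ring_scope.
Local Open Scope quotient_scope.

(* Abelian groups are MathComp's zmodTypes; a "category" below is always a
   small preadditive one, and classes of objects are predicates. *)

Record preadd := Preadd {
  ob :> Type;
  mor : ob -> ob -> zmodType;
  idm : forall A, mor A A;
  mcomp : forall A B D, mor B D -> mor A B -> mor A D;
  mcompA : forall A B D F (h : mor D F) (g : mor B D) (f : mor A B),
    mcomp h (mcomp g f) = mcomp (mcomp h g) f;
  mcomp1m : forall A B (f : mor A B), mcomp (idm B) f = f;
  mcompm1 : forall A B (f : mor A B), mcomp f (idm A) = f;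
  mcompDl : forall A B D (g g' : mor B D) (f : mor A B),
    mcomp (g + g') f = mcomp g f + mcomp g' f;
  mcompDr : forall A B D (g : mor B D) (f f' : mor A B),
    mcomp g (f + f') = mcomp g f + mcomp g f' }.

Arguments mor {p} A B.
Arguments idm {p} A.
Arguments mcomp {p A B D} g f.

Reserved Notation "g ∘ f" (at level 40, left associativity).
Notation "g ∘ f" := (mcomp g f) : ring_scope.

Section Bilinear.
Variable C : preadd.

Lemma mcomp0m A B D (f : mor A B) : (0 : @mor C B D) ∘ f = 0.
Proof. by apply: (addrI (0 ∘ f)); rewrite -mcompDl !addr0. Qed.

Lemma mcompm0 A B D (g : @mor C B D) : g ∘ (0 : mor A B) = 0.
Proof. by apply: (addrI (g ∘ 0)); rewrite -mcompDr !addr0. Qed.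

Lemma mcompNm A B D (g : @mor C B D) (f : mor A B) : (- g) ∘ f = - (g ∘ f).
Proof. by apply: (addrI (g ∘ f)); rewrite -mcompDl !subrr mcomp0m. Qed.

Lemma mcompmN A B D (g : @mor C B D) (f : mor A B) : g ∘ (- f) = - (g ∘ f).
Proof. by apply: (addrI (g ∘ f)); rewrite -mcompDr !subrr mcompm0. Qed.

Lemma mcomp_suml A B D k (g : 'I_k -> @mor C B D) (f : mor A B) :
  (\sum_(j < k) g j) ∘ f = \sum_(j < k) (g j ∘ f).
Proof.
exact: (big_morph (fun g => g ∘ f) (fun x y => mcompDl x y f) (mcomp0m D f)).
Qed.

Lemma mcomp_sumr A B D k (g : @mor C B D) (f : 'I_k -> mor A B) :
  g ∘ (\sum_(j < k) f j) = \sum_(j < k) (g ∘ f j).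
Proof. exact: (big_morph (mcomp g) (mcompDr g) (mcompm0 A g)). Qed.

End Bilinear.

Section CategoryNotions.
Variable C : preadd.
Implicit Types A B D Z : C.

Definition is_iso A B (f : mor A B) : Prop :=
  exists g : mor B A, g ∘ f = idm A /\ f ∘ g = idm B.

Definition isomorphic A B : Prop := exists f : mor A B, is_iso f.

Definition zero_object Z : Prop :=
  forall A, (forall f : mor A Z, f = 0) /\ (forall f : mor Z A, f = 0).

Record biprod A1 A2 B (i1 : mor A1 B) (i2 : mor A2 B)
    (p1 : mor B A1) (p2 : mor B A2) : Prop := Biprod {
  biprod_p1i1 : p1 ∘ i1 = idm A1;
  biprod_p2i2 : p2 ∘ i2 = idm A2;
  biprod_p1i2 : p1 ∘ i2 = 0;
  biprod_p2i1 : p2 ∘ i1 = 0;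
  biprod_sum : i1 ∘ p1 + i2 ∘ p2 = idm B }.

Definition biprod3 A1 A2 A3 B
    (i1 : mor A1 B) (i2 : mor A2 B) (i3 : mor A3 B)
    (p1 : mor B A1) (p2 : mor B A2) (p3 : mor B A3) : Prop :=
  [/\ p1 ∘ i1 = idm A1, p2 ∘ i2 = idm A2 & p3 ∘ i3 = idm A3] /\
  [/\ p1 ∘ i2 = 0, p2 ∘ i1 = 0 & p1 ∘ i3 = 0] /\
  [/\ p3 ∘ i1 = 0, p2 ∘ i3 = 0 & p3 ∘ i2 = 0] /\
  i1 ∘ p1 + i2 ∘ p2 + i3 ∘ p3 = idm B.

Definition additive_cat : Prop :=
  (exists Z, zero_object Z) /\
  (forall A1 A2, exists B i1 i2 p1 p2, @biprod A1 A2 B i1 i2 p1 p2).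

(* B is the coproduct of the finite family F (the zero object when k = 0) *)
Definition finite_coproduct k (F : 'I_k -> C) B : Prop :=
  exists (i_ : forall j, mor (F j) B) (p_ : forall j, mor B (F j)),
    [/\ forall j, p_ j ∘ i_ j = idm (F j),
        forall j l, j <> l -> p_ l ∘ i_ j = 0
      & \sum_(j < k) i_ j ∘ p_ j = idm B].

(* A direct summand comes with a complement: idempotents need not split. *)
Definition direct_summand A B : Prop :=
  exists A' i1 i2 p1 p2, @biprod A A' B i1 i2 p1 p2.

Definition addc (X : C -> Prop) A : Prop :=
  exists k (F : 'I_k -> C) B,
    [/\ forall j, X (F j), finite_coproduct F B & direct_summand A B].

Definition is_kernel A B K (f : mor A B) (k : mor K A) : Prop :=
  f ∘ k = 0 /\
  forall Z (g : mor Z A), f ∘ g = 0 -> exists! h : mor Z K, k ∘ h = g.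

Definition is_cokernel A B Q (f : mor A B) (q : mor B Q) : Prop :=
  q ∘ f = 0 /\
  forall Z (g : mor B Z), g ∘ f = 0 -> exists! h : mor Q Z, h ∘ q = g.

Definition is_mono A B (f : mor A B) : Prop :=
  forall Z (g h : mor Z A), f ∘ g = f ∘ h -> g = h.

Definition is_epi A B (f : mor A B) : Prop :=
  forall Z (g h : mor B Z), g ∘ f = h ∘ f -> g = h.

Definition abelian_cat : Prop :=
  [/\ additive_cat,
      forall A B (f : mor A B), exists K (k : mor K A), is_kernel f k,
      forall A B (f : mor A B), exists Q (q : mor B Q), is_cokernel f q,
      forall A B (f : mor A B), is_mono f -> exists D (g : mor B D), is_kernel g f
    & forall A B (f : mor A B), is_epi f -> exists D (g : mor D A), is_cokernel g f].

Definition weakly_idempotent_complete : Prop :=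
  forall A B (f : mor A B) (s : mor B A), f ∘ s = idm B ->
    exists K (k : mor K A), is_kernel f k.

Definition is_pushout A B A' B' (x : mor A B) (f : mor A A')
    (x' : mor A' B') (f' : mor B B') : Prop :=
  x' ∘ f = f' ∘ x /\
  forall Z (u : mor A' Z) (v : mor B Z), u ∘ f = v ∘ x ->
    exists! w : mor B' Z, w ∘ x' = u /\ w ∘ f' = v.

Definition is_pullback B D B' D' (y : mor B D) (f : mor D' D)
    (y' : mor B' D') (f' : mor B' B) : Prop :=
  f ∘ y' = y ∘ f' /\
  forall Z (u : mor Z D') (v : mor Z B), f ∘ u = y ∘ v ->
    exists! w : mor Z B', y' ∘ w = u /\ f' ∘ w = v.

End CategoryNotions.

Definition conf_class (C : preadd) : Type :=
  forall A B D : C, mor A B -> mor B D -> Prop.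

Section Conflations.
Variables (C : preadd) (conf : conf_class C).

Definition inflation A B (x : @mor C A B) : Prop :=
  exists D (y : mor B D), conf x y.

Definition deflation B D (y : @mor C B D) : Prop :=
  exists A (x : mor A B), conf x y.

(* Quillen's axioms, in the form given by Keller and Buehler *)
Record exact_category : Prop := ExactCategory {
  exact_additive : additive_cat C;
  exact_kernel : forall A B D (x : mor A B) (y : mor B D),
    conf x y -> is_kernel y x;
  exact_cokernel : forall A B D (x : mor A B) (y : mor B D),
    conf x y -> is_cokernel x y;
  exact_isoclosed : forall A B D A' B' D'
      (x : mor A B) (y : mor B D) (x' : mor A' B') (y' : mor B' D')
      (a : mor A A') (b : mor B B') (d : mor D D'),
    is_iso a -> is_iso b -> is_iso d -> b ∘ x = x' ∘ a -> d ∘ y = y' ∘ b ->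
    conf x y -> conf x' y';
  exact_infl_id : forall A : C, inflation (idm A);
  exact_defl_id : forall A : C, deflation (idm A);
  exact_infl_comp : forall A B D (x : mor A B) (x' : mor B D),
    inflation x -> inflation x' -> inflation (x' ∘ x);
  exact_defl_comp : forall A B D (y : mor A B) (y' : mor B D),
    deflation y -> deflation y' -> deflation (y' ∘ y);
  exact_pushout : forall A B A' (x : mor A B) (f : mor A A'), inflation x ->
    exists B' (x' : mor A' B') (f' : mor B B'),
      is_pushout x f x' f' /\ inflation x';
  exact_pullback : forall B D D' (y : mor B D) (f : mor D' D), deflation y ->
    exists B' (y' : mor B' D') (f' : mor B' B),
      is_pullback y f y' f' /\ deflation y' }.

Variable X : C -> Prop.

Definition has_resolution (m : nat) (A : C) : Prop :=
  exists K Y : nat -> C,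
    [/\ K 0%N = A,
        forall i, (i <= m)%N -> X (Y i),
        forall i, (i < m)%N ->
          exists (x : mor (K i.+1) (Y i)) (y : mor (Y i) (K i)), conf x y
      & isomorphic (K m) (Y m)].

Definition has_coresolution (m : nat) (A : C) : Prop :=
  exists K Y : nat -> C,
    [/\ K 0%N = A,
        forall i, (i <= m)%N -> X (Y i),
        forall i, (i < m)%N ->
          exists (x : mor (K i) (Y i)) (y : mor (Y i) (K i.+1)), conf x y
      & isomorphic (K m) (Y m)].

Definition wedge (n : nat) (A : C) : Prop :=
  exists m, (m <= n)%N /\ has_resolution m A.

Definition vee (n : nat) (A : C) : Prop :=
  exists m, (m <= n)%N /\ has_coresolution m A.

Definition preenvelope M D0 (alpha : @mor C M D0) : Prop :=
  forall Z (f : mor M Z), X Z -> exists g : mor D0 Z, f = g ∘ alpha.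

Definition precover M D0 (beta : @mor C D0 M) : Prop :=
  forall Z (f : mor Z M), X Z -> exists g : mor Z D0, f = beta ∘ g.

Definition pseudo_cluster_tilting : Prop :=
  [/\ forall A, X A <-> addc X A,
      forall M, exists D0 D1 (alpha : mor M D0) (beta : mor D0 D1),
        [/\ conf alpha beta, X D0, X D1 & preenvelope alpha]
    & forall M, exists D1 D0 (alpha : mor D1 D0) (beta : mor D0 M),
        [/\ conf alpha beta, X D0, X D1 & precover beta]].

End Conflations.

Section FullSubcategory.
Variables (C : preadd) (P : C -> Prop).

Definition fullsub : preadd := {|
  ob := {A : C | P A};
  mor := fun A B => mor (sval A) (sval B);
  idm := fun A => idm (sval A);
  mcomp := fun A B D g f => mcomp g f;
  mcompA := fun A B D F h g f => mcompA h g f;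
  mcomp1m := fun A B f => mcomp1m f;
  mcompm1 := fun A B f => mcompm1 f;
  mcompDl := fun A B D g g' f => mcompDl g g' f;
  mcompDr := fun A B D g f f' => mcompDr g f f' |}.

End FullSubcategory.

Record ideal (C : preadd) := Ideal {
  imem : forall A B : C, mor A B -> Prop;
  ideal_0 : forall A B, imem (0 : mor A B);
  ideal_B : forall A B (f g : mor A B), imem f -> imem g -> imem (f - g);
  ideal_l : forall A B D (g : mor B D) (f : mor A B), imem f -> imem (g ∘ f);
  ideal_r : forall A B D (g : mor B D) (f : mor A B), imem g -> imem (g ∘ f) }.

Arguments imem {C} i {A B} f.

Section QuotientCategory.
Variables (C : preadd) (J : ideal C).

Section Hom.
Variables A B : C.

Definition ipred : {pred mor A B} := fun f => `[< imem J f >].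

Lemma ipred_zmod_closed : zmod_closed ipred.
Proof.
split=> [|f g Jf Jg]; first exact/asboolP/ideal_0.
by apply/asboolP/ideal_B; apply/asboolP.
Qed.

HB.instance Definition _ :=
  GRing.isZmodClosed.Build (mor A B) ipred ipred_zmod_closed.

Definition qhom : zmodType := Quotient.quot ipred.

Definition qcls (f : mor A B) : qhom := \pi_(Quotient.quot ipred) f.
Definition qrepr (f : qhom) : mor A B := repr (f : Quotient.quot ipred).

Lemma qreprK f : qcls (qrepr f) = f.
Proof. exact: reprK. Qed.

Lemma qclsP (f g : mor A B) : qcls f = qcls g <-> imem J (f - g).
Proof.
rewrite /qcls; split=> [/eqP|Jfg]; first by rewrite -Quotient.idealrBE => /asboolP.
by apply/eqP; rewrite -Quotient.idealrBE; apply/asboolP.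
Qed.

Lemma qclsD (f g : mor A B) : qcls (f + g) = qcls f + qcls g.
Proof. exact: (raddfD (\pi_(Quotient.quot ipred))). Qed.

End Hom.

Definition qcomp A B D (g : qhom B D) (f : qhom A B) : qhom A D :=
  qcls (qrepr g ∘ qrepr f).

Lemma qcompE A B D (g : mor B D) (f : mor A B) :
  qcomp (qcls g) (qcls f) = qcls (g ∘ f).
Proof.
have Jg : imem J (qrepr (qcls g) - g) by apply/qclsP; rewrite qreprK.
have Jf : imem J (f - qrepr (qcls f)) by apply/qclsP; rewrite qreprK.
apply/qclsP; set g' := qrepr _ in Jg *; set f' := qrepr _ in Jf *.
have -> : g' ∘ f' - g ∘ f = (g' - g) ∘ f' - g ∘ (f - f').
  by rewrite mcompDl mcompDr mcompNm mcompmN opprD opprK addrACA addrA addrNK.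
exact: (ideal_B (ideal_r _ Jg) (ideal_l _ Jf)).
Qed.

Lemma qcompA A B D F (h : qhom D F) (g : qhom B D) (f : qhom A B) :
  qcomp h (qcomp g f) = qcomp (qcomp h g) f.
Proof.
by rewrite -(qreprK h) -(qreprK g) -(qreprK f) !qcompE mcompA.
Qed.

Lemma qcomp1m A B (f : qhom A B) : qcomp (qcls (idm B)) f = f.
Proof. by rewrite -(qreprK f) qcompE mcomp1m. Qed.

Lemma qcompm1 A B (f : qhom A B) : qcomp f (qcls (idm A)) = f.
Proof. by rewrite -(qreprK f) qcompE mcompm1. Qed.

Lemma qcompDl A B D (g g' : qhom B D) (f : qhom A B) :
  qcomp (g + g') f = qcomp g f + qcomp g' f.
Proof.
by rewrite -(qreprK g) -(qreprK g') -(qreprK f) -qclsD !qcompE mcompDl qclsD.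
Qed.

Lemma qcompDr A B D (g : qhom B D) (f f' : qhom A B) :
  qcomp g (f + f') = qcomp g f + qcomp g f'.
Proof.
by rewrite -(qreprK g) -(qreprK f) -(qreprK f') -qclsD !qcompE mcompDr qclsD.
Qed.

Definition quotcat : preadd := {|
  ob := C; mor := qhom; idm := fun A => qcls (idm A); mcomp := qcomp;
  mcompA := qcompA; mcomp1m := qcomp1m; mcompm1 := qcompm1;
  mcompDl := qcompDl; mcompDr := qcompDr |}.

End QuotientCategory.

Section FactorIdeal.
Variables (C : preadd) (P : C -> Prop).

(* The ideal generated by the morphisms factoring through an object of P.
   Finite sums make it an ideal without any hypothesis on P; they are
   superfluous when P is closed under finite coproducts: see [factor_idealP]. *)
Definition factors A B (f : @mor C A B) : Prop :=
  exists k (Z : 'I_k -> C) (h : forall j, mor (Z j) B) (g : forall j, mor A (Z j)),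
    (forall j, P (Z j)) /\ f = \sum_(j < k) h j ∘ g j.

Lemma factors0 A B : factors (0 : @mor C A B).
Proof.
pose F0 (T : 'I_0 -> Type) (j : 'I_0) : T j :=
  False_rect _ (notF (ltn_ord j)).
exists 0%N, (F0 _), (F0 _), (F0 _); split; last by rewrite big_ord0.
by case.
Qed.

Lemma factorsB A B (f g : @mor C A B) : factors f -> factors g -> factors (f - g).
Proof.
move=> [k [Z [h [u [PZ ->]]]]] [k' [Z' [h' [u' [PZ' ->]]]]].
pose ZZ (s : 'I_k + 'I_k') := match s with inl j => Z j | inr j => Z' j end.
pose hh s : mor (ZZ s) B := match s with inl j => h j | inr j => - h' j end.
pose uu s : mor A (ZZ s) := match s with inl j => u j | inr j => u' j end.
exists (k + k')%N, (fun j => ZZ (split j)), (fun j => hh (split j)),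
  (fun j => uu (split j)); split.
  by move=> j; case: (split j).
rewrite big_split_ord /=; congr (_ + _).
  by apply: eq_bigr => j _; rewrite (unsplitK (inl j : 'I_k + 'I_k')).
rewrite -sumrN; apply: eq_bigr => j _.
by rewrite (unsplitK (inr j : 'I_k + 'I_k')) /= mcompNm.
Qed.

Lemma factors_l A B D (g : @mor C B D) (f : mor A B) : factors f -> factors (g ∘ f).
Proof.
move=> [k [Z [h [u [PZ ->]]]]]; exists k, Z, (fun j => g ∘ h j), u; split=> //.
by rewrite mcomp_sumr; apply: eq_bigr => j _; rewrite mcompA.
Qed.

Lemma factors_r A B D (g : @mor C B D) (f : mor A B) : factors g -> factors (g ∘ f).
Proof.
move=> [k [Z [h [u [PZ ->]]]]]; exists k, Z, h, (fun j => u j ∘ f); split=> //.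
by rewrite mcomp_suml; apply: eq_bigr => j _; rewrite mcompA.
Qed.

Definition factor_ideal : ideal C := {|
  imem := factors; ideal_0 := factors0; ideal_B := factorsB;
  ideal_l := factors_l; ideal_r := factors_r |}.

Lemma factor_idealP :
  (exists Z, zero_object Z /\ P Z) ->
  (forall A B, P A -> P B -> exists S i1 i2 p1 p2,
    @biprod C A B S i1 i2 p1 p2 /\ P S) ->
  forall A B (f : @mor C A B), imem factor_ideal f <->
    exists Z (h : mor Z B) (g : mor A Z), P Z /\ f = h ∘ g.
Proof.
move=> [O [_ PO]] PD A B f; split; last first.
  move=> [Z [h [g [PZ ->]]]].
  by exists 1%N, (fun _ => Z), (fun _ => h), (fun _ => g); rewrite big_ord1.
move=> [k]; elim: k f => [|k IH] f [Z [h [g [PZ ->]]]].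
  by exists O, 0, 0; split=> //; rewrite big_ord0 mcomp0m.
have [|Z' [h' [g' [PZ' e]]]] := IH (\sum_(j < k) h (lift ord0 j) ∘ g (lift ord0 j)).
  by exists (fun j => Z (lift ord0 j)), (fun j => h (lift ord0 j)),
    (fun j => g (lift ord0 j)).
have [S [i1 [i2 [p1 [p2 [[e1 e2 e3 e4 _] PS]]]]]] := PD _ _ (PZ ord0) PZ'.
exists S, (h ord0 ∘ p1 + h' ∘ p2), (i1 ∘ g ord0 + i2 ∘ g'); split=> //.
have K T U V W Y (a : @mor C V W) (p : mor U V) (i : mor T U) (b : mor Y T) :
  (a ∘ p) ∘ (i ∘ b) = a ∘ (p ∘ i) ∘ b by rewrite !mcompA.
rewrite big_ord_recl e mcompDl !mcompDr !K e1 e2 e3 e4.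
by rewrite !mcompm0 !mcomp0m !mcompm1 addr0 add0r.
Qed.

End FactorIdeal.

Section ConflationCategory.
Variables (C : preadd) (conf : conf_class C).

Record confob := Confob {
  co1 : C; co2 : C; co3 : C;
  cof : mor co1 co2;
  cog : mor co2 co3;
  cofgP : conf cof cog }.

Section Hom.
Variables A B : confob.

Local Notation triple :=
  (mor (co1 A) (co1 B) * mor (co2 A) (co2 B) * mor (co3 A) (co3 B))%type.

Definition commutes : {pred triple} := fun t =>
  (cof B ∘ t.1.1 == t.1.2 ∘ cof A) && (cog B ∘ t.1.2 == t.2 ∘ cog A).

Lemma commutes_zmod_closed : zmod_closed commutes.
Proof.
split=> [|t u]; first by rewrite unfold_in /commutes /= !mcompm0 !mcomp0m !eqxx.
rewrite !unfold_in /commutes => /andP[/eqP t1 /eqP t2] /andP[/eqP u1 /eqP u2] /=.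
by rewrite !mcompDl !mcompDr !mcompNm !mcompmN t1 t2 u1 u2 !eqxx.
Qed.

HB.instance Definition _ :=
  GRing.isZmodClosed.Build triple commutes commutes_zmod_closed.

Record confhom := Confhom { chval : triple; _ : chval \in commutes }.

HB.instance Definition _ := [isSub for chval].
HB.instance Definition _ := [Choice of confhom by <:].
HB.instance Definition _ := [SubChoice_isSubZmodule of confhom by <:].

Definition chom1 (t : confhom) := (chval t).1.1.
Definition chom2 (t : confhom) := (chval t).1.2.
Definition chom3 (t : confhom) := (chval t).2.

Lemma confhom_eq (t u : confhom) :
  chom1 t = chom1 u -> chom2 t = chom2 u -> chom3 t = chom3 u -> t = u.
Proof.
case: t u => [[[t1 t2] t3] ?] [[[u1 u2] u3] ?] e1 e2 e3.
by apply: val_inj; move: e1 e2 e3; rewrite /chom1 /chom2 /chom3 /= => -> -> ->.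
Qed.

End Hom.

Lemma ch_id_subproof A : ((idm (co1 A), idm (co2 A)), idm (co3 A)) \in @commutes A A.
Proof. by rewrite unfold_in /commutes /= !mcompm1 !mcomp1m !eqxx. Qed.

Definition ch_id A : confhom A A := Confhom (ch_id_subproof A).

Lemma ch_comp_subproof A B D (g : confhom B D) (f : confhom A B) :
  ((chom1 g ∘ chom1 f, chom2 g ∘ chom2 f), chom3 g ∘ chom3 f) \in @commutes A D.
Proof.
have := valP g; have := valP f; rewrite !unfold_in /commutes /= -!/(chom1 _).
rewrite -!/(chom2 _) -!/(chom3 _) => /andP[/eqP f1 /eqP f2] /andP[/eqP g1 /eqP g2].
by rewrite !mcompA g1 g2 -!mcompA f1 f2 !eqxx.
Qed.

Definition ch_comp A B D (g : confhom B D) (f : confhom A B) : confhom A D :=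
  Confhom (ch_comp_subproof g f).

Definition confcat : preadd.
Proof.
refine (@Preadd confob (fun A B => confhom A B) ch_id ch_comp _ _ _ _ _).
- by move=> *; apply: confhom_eq; rewrite /chom1 /chom2 /chom3 /= mcompA.
- by move=> *; apply: confhom_eq; rewrite /chom1 /chom2 /chom3 /= mcomp1m.
- by move=> *; apply: confhom_eq; rewrite /chom1 /chom2 /chom3 /= mcompm1.
- by move=> *; apply: confhom_eq; rewrite /chom1 /chom2 /chom3 /= mcompDl.
- by move=> *; apply: confhom_eq; rewrite /chom1 /chom2 /chom3 /= mcompDr.
Defined.

Definition degreewise : conf_class confcat := fun A B D f g =>
  [/\ conf (chom1 f) (chom1 g), conf (chom2 f) (chom2 g)
    & conf (chom3 f) (chom3 g)].

Definition split_conflation : confcat -> Prop := fun A =>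
  exists (s : mor (co3 A) (co2 A)) (r : mor (co2 A) (co1 A)),
    biprod (cof A) s r (cog A).

End ConflationCategory.

Record bifunctor (C : preadd) := Bifunctor {
  bob :> C -> C -> zmodType;
  push : forall (Z A A' : C), mor A A' -> bob Z A -> bob Z A';
  pull : forall (Z Z' A : C), mor Z' Z -> bob Z A -> bob Z' A;
  pushDr : forall Z A A' (a : mor A A') (x y : bob Z A),
    push a (x + y) = push a x + push a y;
  pushDl : forall Z A A' (a b : mor A A') (x : bob Z A),
    push (a + b) x = push a x + push b x;
  push1 : forall Z A (x : bob Z A), push (idm A) x = x;
  pushM : forall Z A A' A'' (b : mor A' A'') (a : mor A A') (x : bob Z A),
    push (b ∘ a) x = push b (push a x);
  pullDr : forall Z Z' A (c : mor Z' Z) (x y : bob Z A),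
    pull c (x + y) = pull c x + pull c y;
  pullDl : forall Z Z' A (c d : mor Z' Z) (x : bob Z A),
    pull (c + d) x = pull c x + pull d x;
  pull1 : forall Z A (x : bob Z A), pull (idm Z) x = x;
  pullM : forall Z Z' Z'' A (c : mor Z' Z) (d : mor Z'' Z') (x : bob Z A),
    pull (c ∘ d) x = pull d (pull c x);
  push_pull : forall Z Z' A A' (a : mor A A') (c : mor Z' Z) (x : bob Z A),
    push a (pull c x) = pull c (push a x) }.

Arguments push {C} _ {Z A A'} _ _.
Arguments pull {C} _ {Z Z' A} _ _.

(* [real d x y]: the sequence (x, y) belongs to the equivalence class s(d). *)
Record extriangulated := Extriangulated {
  excat :> preadd;
  excat_additive : additive_cat excat;
  EE : bifunctor excat;
  real : forall A B D : excat, EE D A -> mor A B -> mor B D -> Prop;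
  real_ex : forall A D (d : EE D A),
    exists B (x : mor A B) (y : mor B D), real d x y;
  real_class : forall A B B' D (d : EE D A) (x : mor A B) (y : mor B D)
      (x' : mor A B') (y' : mor B' D), real d x y ->
    (real d x' y' <->
     exists b : mor B B', [/\ is_iso b, b ∘ x = x' & y' ∘ b = y]);
  real_mor : forall A B D A' B' D' (d : EE D A) (d' : EE D' A')
      (x : mor A B) (y : mor B D) (x' : mor A' B') (y' : mor B' D')
      (a : mor A A') (c : mor D D'),
    real d x y -> real d' x' y' -> push EE a d = pull EE c d' ->
    exists b : mor B B', b ∘ x = x' ∘ a /\ y' ∘ b = c ∘ y;
  real_0 : forall A D B (iA : mor A B) (iD : mor D B) pA pD,
    biprod iA iD pA pD -> real (0 : EE D A) iA pD;
  real_D : forall A B D A' B' D' (d : EE D A) (d' : EE D' A')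
      (x : mor A B) (y : mor B D) (x' : mor A' B') (y' : mor B' D')
      SA (iA : mor A SA) (iA' : mor A' SA) pA pA'
      SB (iB : mor B SB) (iB' : mor B' SB) pB pB'
      SD (iD : mor D SD) (iD' : mor D' SD) pD pD',
    biprod iA iA' pA pA' -> biprod iB iB' pB pB' -> biprod iD iD' pD pD' ->
    real d x y -> real d' x' y' ->
    real (push EE iA (pull EE pD d) + push EE iA' (pull EE pD' d'))
         (iB ∘ x ∘ pA + iB' ∘ x' ∘ pA') (iD ∘ y ∘ pB + iD' ∘ y' ∘ pB');
  ET3 : forall A B D A' B' D' (d : EE D A) (d' : EE D' A')
      (x : mor A B) (y : mor B D) (x' : mor A' B') (y' : mor B' D')
      (a : mor A A') (b : mor B B'),
    real d x y -> real d' x' y' -> b ∘ x = x' ∘ a ->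
    exists c : mor D D', c ∘ y = y' ∘ b /\ push EE a d = pull EE c d';
  ET3op : forall A B D A' B' D' (d : EE D A) (d' : EE D' A')
      (x : mor A B) (y : mor B D) (x' : mor A' B') (y' : mor B' D')
      (b : mor B B') (c : mor D D'),
    real d x y -> real d' x' y' -> c ∘ y = y' ∘ b ->
    exists a : mor A A', b ∘ x = x' ∘ a /\ push EE a d = pull EE c d';
  ET4 : forall A B C D F (d : EE D A) (d' : EE F B)
      (f : mor A B) (f' : mor B D) (g : mor B C) (g' : mor C F),
    real d f f' -> real d' g g' ->
    exists G (h' : mor C G) (u : mor D G) (v : mor G F) (d'' : EE G A),
      [/\ h' ∘ g = u ∘ f', v ∘ h' = g' & real d'' (g ∘ f) h'] /\
      [/\ real (push EE f' d') u v, pull EE u d'' = d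
        & push EE f d'' = pull EE v d'];
  ET4op : forall A B C D F (d : EE B D) (d' : EE C F)
      (f' : mor D A) (f : mor A B) (g' : mor F B) (g : mor B C),
    real d f' f -> real d' g' g ->
    exists G (h' : mor G A) (u : mor D G) (v : mor G F) (d'' : EE C G),
      [/\ f ∘ h' = g' ∘ v, h' ∘ u = f' & real d'' h' (g ∘ f)] /\
      [/\ real (pull EE g' d) u v, push EE v d'' = d'
        & push EE u d = pull EE g d''] }.

Arguments EE : clear implicits.
Arguments real {e A B D} _ _ _.

Section Extriangulated.
Variable C : extriangulated.

Definition econf : conf_class C := fun A B D x y => exists d, real d x y.

Definition E_injective (I : C) : Prop :=
  forall A B (x : mor A B), inflation econf x ->
    forall f : mor A I, exists g : mor B I, g ∘ x = f.

Definition enough_injectives : Prop :=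
  forall A : C, exists I (x : mor A I), E_injective I /\ inflation econf x.

Definition E_projective_mor A B (f : @mor C A B) : Prop :=
  forall W (x : EE C B W), pull (EE C) f x = 0.

Definition E_injective_mor A B (f : @mor C A B) : Prop :=
  forall W (x : EE C W A), push (EE C) f x = 0.

Record etriangle (A B D : C) := Etriangle {
  tx : mor A B;
  ty : mor B D;
  td : EE C D A;
  tP : real td tx ty }.

Record etri_mor A B D A' B' D' (T : etriangle A B D) (T' : etriangle A' B' D')
    (a : mor A A') (b : mor B B') (c : mor D D') : Prop := EtriMor {
  etri_mor_x : b ∘ tx T = tx T' ∘ a;
  etri_mor_y : c ∘ ty T = ty T' ∘ b;
  etri_mor_d : push (EE C) a (td T) = pull (EE C) c (td T') }.

Definition ext_of (h : nat -> bifunctor C) (i : nat) : bifunctor C :=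
  if i is j.+1 then h j else EE C.

Definition exact_at (U V W : zmodType) (f : U -> V) (g : V -> W) : Prop :=
  forall v, g v = 0 <-> exists u, v = f u.

End Extriangulated.

Arguments E_injective {C} I.
Arguments econf : clear implicits.

(* The index is shifted by one: [hext j] is E^(j+2) and [Ext i] is E^(i+1), so
   that [Ext 0] is the given bifunctor E itself. *)
Record higher_extensions (C : extriangulated) := HigherExtensions {
  hext : nat -> bifunctor C;
  Ext := ext_of hext;
  con1 : forall i (A B D : C), etriangle A B D ->
    forall W, Ext i A W -> Ext i.+1 D W;
  con2 : forall i (A B D : C), etriangle A B D ->
    forall W, Ext i W D -> Ext i.+1 W A;
  con1_D : forall i A B D (T : etriangle A B D) W (x y : Ext i A W),
    con1 T (x + y) = con1 T x + con1 T y;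
  con2_D : forall i A B D (T : etriangle A B D) W (x y : Ext i W D),
    con2 T (x + y) = con2 T x + con2 T y;
  con1_nat : forall i A B D (T : etriangle A B D) W W' (w : mor W W') (x : Ext i A W),
    con1 T (push (Ext i) w x) = push (Ext i.+1) w (con1 T x);
  con2_nat : forall i A B D (T : etriangle A B D) W W' (w : mor W' W) (x : Ext i W D),
    con2 T (pull (Ext i) w x) = pull (Ext i.+1) w (con2 T x);
  con1_mor : forall i A B D A' B' D' (T : etriangle A B D) (T' : etriangle A' B' D')
      a b c, etri_mor T T' a b c -> forall W (x : Ext i A' W),
    pull (Ext i.+1) c (con1 T' x) = con1 T (pull (Ext i) a x);
  con2_mor : forall i A B D A' B' D' (T : etriangle A B D) (T' : etriangle A' B' D')
      a b c, etri_mor T T' a b c -> forall W (x : Ext i W D),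
    push (Ext i.+1) a (con2 T x) = con2 T' (push (Ext i) c x);
  con1_exact : forall i A B D (T : etriangle A B D) W,
    exact_at (@pull _ (Ext i) D B W (ty T)) (@pull _ (Ext i) B A W (tx T)) /\
    exact_at (@pull _ (Ext i) B A W (tx T)) (@con1 i A B D T W);
  con2_exact : forall i A B D (T : etriangle A B D) W,
    exact_at (@push _ (Ext i) W A B (tx T)) (@push _ (Ext i) W B D (ty T)) /\
    exact_at (@push _ (Ext i) W B D (ty T)) (@con2 i A B D T W);
  Ext_proj : forall i A B (f : @mor C A B), E_projective_mor f ->
    forall W (x : Ext i B W), pull (Ext i) f x = 0;
  Ext_inj : forall i A B (f : @mor C A B), E_injective_mor f ->
    forall W (x : Ext i W A), push (Ext i) f x = 0 }.

Arguments Ext {C} h i.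

(* E^i(X, X') = 0 for 1 <= i <= m *)
Definition ext_orthogonal (C : extriangulated) (H : higher_extensions C)
    (m : nat) (X : C -> Prop) : Prop :=
  forall A B, X A -> X B -> forall i, (i < m)%N -> forall x : Ext H i A B, x = 0.

Definition rigid (C : extriangulated) (H : higher_extensions C)
    (k : nat) (X : C -> Prop) : Prop := ext_orthogonal H k.-1 X.

Record addfun (C : preadd) := Addfun {
  fob :> C -> zmodType;
  fmap : forall A B : C, mor A B -> fob A -> fob B;
  fmapDr : forall A B (f : mor A B) (x y : fob A),
    fmap f (x + y) = fmap f x + fmap f y;
  fmapDl : forall A B (f g : mor A B) (x : fob A),
    fmap (f + g) x = fmap f x + fmap g x;
  fmap1 : forall A (x : fob A), fmap (idm A) x = x;
  fmapM : forall A B D (g : mor B D) (f : mor A B) (x : fob A),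
    fmap (g ∘ f) x = fmap g (fmap f x) }.

Arguments fmap {C} a {A B} _ _.

Record nattrans (C : preadd) (F G : addfun C) := Nattrans {
  ntf :> forall A : C, F A -> G A;
  ntD : forall A (x y : F A), ntf (x + y) = ntf x + ntf y;
  nt_nat : forall (A B : C) (f : mor A B) (x : F A),
    ntf (fmap F f x) = fmap G f (ntf x) }.

Arguments ntf {C F G} _ {A} _.

Section Functors.
Variable C : preadd.

Definition nt_comp (F G H : addfun C) (b : nattrans G H) (a : nattrans F G) :
  nattrans F H.
Proof.
refine (@Nattrans _ F H (fun A x => ntf b (ntf a x)) _ _).
- by move=> *; rewrite !ntD.
- by move=> *; rewrite !nt_nat.
Defined.

Definition nt_iso (F G : addfun C) (a : nattrans F G) : Prop :=
  exists b : nattrans G F,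
    (forall A (x : F A), ntf b (ntf a x) = x) /\
    (forall A (x : G A), ntf a (ntf b x) = x).

Definition nt_epi (F G : addfun C) (a : nattrans F G) : Prop :=
  forall A (y : G A), exists x : F A, y = ntf a x.

Definition nt_exact (F G H : addfun C) (a : nattrans F G) (b : nattrans G H) : Prop :=
  forall A, exact_at (@ntf _ _ _ a A) (@ntf _ _ _ b A).

(* Exactness of 0 -> F -> G -> H -> 0; in functor categories it is pointwise. *)
Definition short_exact (F G H : addfun C) (a : nattrans F G) (b : nattrans G H) : Prop :=
  [/\ forall A (x : F A), ntf a x = 0 -> x = 0, nt_exact a b & nt_epi b].

Definition yoneda (A : C) : addfun C := {|
  fob := fun B => mor A B;
  fmap := fun B D g f => g ∘ f;
  fmapDr := fun B D g f f' => mcompDr g f f';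
  fmapDl := fun B D g g' f => mcompDl g g' f;
  fmap1 := fun B f => mcomp1m f;
  fmapM := fun B D F h g f => esym (mcompA h g f) |}.

Definition restrict_fun (P : C -> Prop) (F : addfun C) : addfun (fullsub P) :=
  @Addfun (fullsub P) (fun A => F (sval A)) (fun A B f x => fmap F f x)
    (fun A B => @fmapDr _ F (sval A) (sval B))
    (fun A B => @fmapDl _ F (sval A) (sval B))
    (fun A => @fmap1 _ F (sval A))
    (fun A B D => @fmapM _ F (sval A) (sval B) (sval D)).

Lemma fmap0 (F : addfun C) A B (x : F A) : fmap F (0 : mor A B) x = 0.
Proof. by apply: (addrI (fmap F 0 x)); rewrite -fmapDl !addr0. Qed.

Lemma fmapN (F : addfun C) A B (f : mor A B) (x : F A) :
  fmap F (- f) x = - fmap F f x.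
Proof. by apply: (addrI (fmap F f x)); rewrite -fmapDl !subrr fmap0. Qed.

End Functors.

Section InducedFunctor.
Variables (C : preadd) (J : ideal C) (F : addfun C).
Hypothesis FJ : forall A B (f : mor A B), imem J f -> forall x : F A, fmap F f x = 0.

Lemma induced_mapE A B (f : mor A B) (x : F A) :
  fmap F (qrepr (qcls J f)) x = fmap F f x.
Proof.
apply/eqP; rewrite -subr_eq0 -fmapN -fmapDl; apply/eqP/FJ/qclsP.
by rewrite qreprK.
Qed.

Definition induced : addfun (quotcat J).
Proof.
refine (@Addfun (quotcat J) F (fun A B f x => fmap F (qrepr f) x) _ _ _ _).
- by move=> A B f x y; apply: fmapDr.
- move=> A B f g x.
  by rewrite -{1}(qreprK f) -{1}(qreprK g) -qclsD induced_mapE fmapDl.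
- by move=> A x; rewrite induced_mapE fmap1.
- by move=> A B D g f x; rewrite induced_mapE fmapM.
Defined.

End InducedFunctor.

Section Setting.
Variables (C : extriangulated) (X : C -> Prop) (n : nat).
Local Notation E := (EE C).

Definition Xn : preadd := fullsub (wedge (econf C) X n).

Lemma push0 (F : bifunctor C) (Z A B : C) (x : F Z A) : push F (0 : mor A B) x = 0.
Proof. by apply: (addrI (push F 0 x)); rewrite -pushDl !addr0. Qed.

Lemma pushr0 (F : bifunctor C) (Z A B : C) (f : mor A B) : push F f (0 : F Z A) = 0.
Proof. by apply: (addrI (push F f 0)); rewrite -pushDr !addr0. Qed.

Lemma pushN (F : bifunctor C) (Z A B : C) (f : mor A B) (x : F Z A) :
  push F (- f) x = - push F f x.
Proof. by apply: (addrI (push F f x)); rewrite -pushDl !subrr push0. Qed.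

Lemma pull0 (F : bifunctor C) (Z W A : C) (x : F W A) : pull F (0 : mor Z W) x = 0.
Proof. by apply: (addrI (pull F 0 x)); rewrite -pullDl !addr0. Qed.

Lemma pullN (F : bifunctor C) (Z W A : C) (f : mor Z W) (x : F W A) :
  pull F (- f) x = - pull F f x.
Proof. by apply: (addrI (pull F f x)); rewrite -pullDl !subrr pull0. Qed.

Definition inj_ideal : ideal Xn.
Proof.
refine (@Ideal Xn (fun A B (f : @mor C (sval A) (sval B)) => E_injective_mor f)
  _ _ _ _) => /=.
- by move=> A B W x; rewrite push0.
- by move=> A B f g Hf Hg W x; rewrite pushDl pushN Hf Hg subr0.
- by move=> A B D g f Hf W x; rewrite pushM Hf pushr0.
- by move=> A B D g f Hg W x; rewrite pushM Hg.
Defined.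

Definition Xbar : preadd := quotcat inj_ideal.

Definition Ecov (M : C) : addfun C := {|
  fob := fun A => E M A;
  fmap := fun A B f x => push E f x;
  fmapDr := fun A B f x y => pushDr f x y;
  fmapDl := fun A B f g x => pushDl f g x;
  fmap1 := fun A x => push1 x;
  fmapM := fun A B D g f x => pushM g f x |}.

Lemma Ecov_inj (M : C) (A B : Xn) (f : mor A B) :
  imem inj_ideal f -> forall x, fmap (restrict_fun _ (Ecov M)) f x = 0.
Proof. by move=> Hf x; apply: Hf. Qed.

Definition Ebar (M : C) : addfun Xbar := induced (@Ecov_inj M).

Definition Ebar_mor (M M' : C) (h : mor M M') : nattrans (Ebar M') (Ebar M).
Proof.
refine (@Nattrans Xbar (Ebar M') (Ebar M) (fun A x => pull E h x) _ _).
- by move=> A x y; apply: pullDr.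
- by move=> A B f x; apply: esym; apply: push_pull.
Defined.

Definition Xn1 : preadd := fullsub (wedge (econf C) X n.+1).

Definition M2 : preadd :=
  quotcat (factor_ideal (fun A : Xn1 => X (sval A))).

Definition cls (M M' : M2) (h : @mor C (sval M) (sval M')) : mor M M' :=
  qcls (factor_ideal (fun A : Xn1 => X (sval A))) (h : @mor Xn1 M M').

Definition Kob (M : M2) : addfun Xbar := Ebar (sval M).

(* Independent of the representative: see [Kmor_cls]. *)
Definition Kmor (M M' : M2) (h : mor M M') : nattrans (Kob M') (Kob M) :=
  @Ebar_mor (sval M) (sval M') (qrepr h).

Definition eps_K : conf_class M2 := fun A B D f g =>
  short_exact (Kmor g) (Kmor f).

(* The objects of L_X^n, a full subcategory of the functors on Xbar. *)
Definition in_L (G : addfun Xbar) : Prop :=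
  exists (X0 X1 : Xbar) (a : nattrans (yoneda X0) (yoneda X1))
         (b : nattrans (yoneda X1) G),
    [/\ X (sval X0), nt_exact a b & nt_epi b].

Definition L_conflation (F G H : addfun Xbar) (a : nattrans F G)
    (b : nattrans G H) : Prop :=
  [/\ in_L F, in_L G, in_L H & short_exact a b].

Section KWellDefined.
Variable H : higher_extensions C.
Hypothesis Xrigid : rigid H n.+2 X.

Lemma Ext_resolution (m : nat) (A Z : C) : has_resolution (econf C) X m Z -> X A ->
  forall i, (i + m < n.+1)%N -> forall x : Ext H i A Z, x = 0.
Proof.
move=> hZ XA; elim: m Z hZ => [|m IH] Z [K [Y [<- XY hK [f [g [gf fg]]]]]] i lt_i x.
  rewrite -(push1 x) -gf pushM.
  by rewrite (Xrigid XA (XY 0%N isT) (i := i) _ (push (Ext H i) f x)) ?pushr0 // -(addn0 i).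
have [u [v [d duv]]] := hK 0%N isT.
have hK1 : has_resolution (econf C) X m (K 1%N).
  exists (fun j => K j.+1), (fun j => Y j.+1); split=> //.
  - by move=> j le_j; apply: XY.
  - by move=> j le_j; apply: hK.
  - by exists f, g.
have lt_i' : (i.+1 + m < n.+1)%N by rewrite addSnnS.
have [_ ex] := con2_exact H i (Etriangle duv) A.
have [y ->] := (ex x).1 (IH _ hK1 _ lt_i' _).
have lt_in : (i < n.+1)%N by apply: leq_ltn_trans lt_i; apply: leq_addr.
by rewrite (Xrigid XA (XY 0%N isT) lt_in y) pushr0.
Qed.

Lemma E_wedge (A Z : C) (x : E A Z) : X A -> wedge (econf C) X n Z -> x = 0.
Proof. by move=> XA [m [le_mn hZ]]; apply: (Ext_resolution hZ XA (i := 0%N)). Qed.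

Lemma Kmor_cls (M M' : M2) (h : @mor C (sval M) (sval M')) (A : Xbar) (x : Kob M' A) :
  ntf (Kmor (cls h)) x = pull E h x.
Proof.
have /qclsP [k [Z [f [g [XZ e]]]]] := qreprK (cls h).
apply/eqP; rewrite -subr_eq0 -pullN -pullDl; apply/eqP.
rewrite [X in pull _ X](e : _ = _).
elim/big_rec: _ => [|j y _ IH]; first exact: pull0.
rewrite pullDl IH addr0 pullM (E_wedge (pull E (f j) x) (XZ j) (svalP A)).
by apply: (addrI (pull E (g j) 0)); rewrite -pullDr !addr0.
Qed.

End KWellDefined.

End Setting.

(* Main.v *)
Require Import Defs.
From mathcomp Require Import all_boot all_algebra boolp.

Set Implicit Arguments.
Unset Strict Implicit.
Unset Printing Implicit Defensive.

Import GRing.Theory.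
Local Open Scope ring_scope.

(** Parts (a) and (b) hold for the conflations of any exact category.  A
    conflation P : A -> B -> D embeds into the split conflation
    B -> B ⊕ D -> D with split cokernel, and is a quotient of
    A -> A ⊕ B -> B with split kernel; these are the preenvelope and the
    precover ([split_hull], [split_cover]).  They also show that a morphism of
    conflations factors through split ones iff it is null-homotopic, that is,
    iff its third component lifts along the deflation of its target, iff its
    first component extends along the inflation of its source
    ([factors_split3], [factors_split1]).  Consequently, in the quotient, a
    morphism P -> Q factors through the pullback of Q along its third component
    as e followed by m, where e is the identity on third terms and m is the
    identity on first terms.  Such an e is the cokernel of its kernel, a pullback
    of P, and dually for m ([stable_ker_coker], [stable_coker_ker]), which makes
    the quotient abelian ([stable_abelian]).

    That M2 is exact comes from its embedding by K.  If K_M -> Y_M -> M is the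
    first triangle of a resolution of M, then E(M, -) is generated on objects with
    a resolution of length at most n by the class of this triangle in E(M, K_M),
    subject to the one relation that it vanishes in E(M, Y_M), because
    E(Y_M, -) = 0 there by rigidity.  So a morphism M' -> M in M2 amounts to an
    element of E(M', K_M) that vanishes in E(M', Y_M) ([kap_full],
    [kap_faithful_at]).  The functors in the image of K are closed under
    extensions: a horseshoe argument presents an extension by a triangular
    matrix K_D ⊕ K_A -> Y_D ⊕ Y_A, which is an inflation of C, and its cone
    represents the extension ([eps_extension]).  The composites, pushouts and
    pullbacks in the axioms of an exact category are all represented by such
    extensions ([M2_exact]).

    For a split monomorphism a : K -> M of M2, a retraction up to a morphism
    factoring through X becomes a true retraction in C after adding summands
    X0 in X and I injective to M, where the summand I makes the morphism out of
    K an inflation ([split_mono_complement]).  Its cone N' is a summand of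
    M ⊕ X0 ⊕ I, and the objects with a resolution of length at most n+1 are
    closed under summands by Schanuel's lemma ([resdim_le_summand]); so N' lies in
    M2.  This yields both weak idempotent completeness and the triangle of
    part (c), where the isomorphism K(N') -> K(N) is the one between two kernels
    of K(M) -> K(K). *)

(** * Preadditive categories *)

Definition mcompE := (mcompDl, mcompDr, mcompNm, mcompmN, mcompA, mcomp0m,
  mcompm0, mcomp1m, mcompm1, oppr0, addr0, add0r).

Section Preadditive.
Variable C : preadd.
Implicit Types A B D Z S : C.

Lemma mcomp_eql A B D (g : mor B D) (f : mor A B) h : g ∘ f = h ->
  forall W (u : mor D W), u ∘ g ∘ f = u ∘ h.
Proof. by move=> <- W u; rewrite mcompA. Qed.

(** The matrix calculus of a biproduct, as rewriting rules for left-associated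
    composites. *)
Lemma biprodE A1 A2 S (i1 : mor A1 S) (i2 : mor A2 S) p1 p2 :
  biprod i1 i2 p1 p2 ->
  (p1 ∘ i1 = idm A1) * (p2 ∘ i2 = idm A2) * (p1 ∘ i2 = 0) * (p2 ∘ i1 = 0) *
  (forall W (u : mor A1 W), u ∘ p1 ∘ i1 = u) *
  (forall W (u : mor A2 W), u ∘ p2 ∘ i2 = u) *
  (forall W (u : mor A1 W), u ∘ p1 ∘ i2 = 0) *
  (forall W (u : mor A2 W), u ∘ p2 ∘ i1 = 0).
Proof.
case=> e1 e2 e3 e4 _; do ![split=> //] => W u.
- by rewrite (mcomp_eql e1) mcompm1.
- by rewrite (mcomp_eql e2) mcompm1.
- by rewrite (mcomp_eql e3) mcompm0.
by rewrite (mcomp_eql e4) mcompm0.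
Qed.

Lemma biprod_eq_in A1 A2 S (i1 : mor A1 S) (i2 : mor A2 S) p1 p2 :
  biprod i1 i2 p1 p2 ->
  forall W (f g : mor S W), f ∘ i1 = g ∘ i1 -> f ∘ i2 = g ∘ i2 -> f = g.
Proof.
move=> bp W f g e1 e2; rewrite -[f]mcompm1 -[g]mcompm1 -(biprod_sum bp).
by rewrite !mcompE e1 e2.
Qed.

Lemma biprod_eq_out A1 A2 S (i1 : mor A1 S) (i2 : mor A2 S) p1 p2 :
  biprod i1 i2 p1 p2 ->
  forall W (f g : mor W S), p1 ∘ f = p1 ∘ g -> p2 ∘ f = p2 ∘ g -> f = g.
Proof.
move=> bp W f g e1 e2; rewrite -[f]mcomp1m -[g]mcomp1m -(biprod_sum bp).
by rewrite !mcompDl -!mcompA e1 e2.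
Qed.

Lemma biprodC A1 A2 S (i1 : mor A1 S) (i2 : mor A2 S) p1 p2 :
  biprod i1 i2 p1 p2 -> biprod i2 i1 p2 p1.
Proof. by case=> e1 e2 e3 e4 e; split; rewrite // addrC. Qed.

Lemma biprod_zero A Z : zero_object Z ->
  biprod (idm A) (0 : mor Z A) (idm A) (0 : mor A Z).
Proof.
move=> Z0; split; rewrite ?mcomp1m ?mcomp0m ?mcompm0 ?addr0 //.
by rewrite [RHS](Z0 Z).1.
Qed.

Lemma zero_of_id Z : idm Z = 0 -> zero_object Z.
Proof.
by move=> e A; split=> f; [rewrite -[f]mcomp1m | rewrite -[f]mcompm1];
  rewrite e ?mcomp0m ?mcompm0.
Qed.

Lemma is_iso_id A : is_iso (idm A).
Proof. by exists (idm A); rewrite mcomp1m. Qed.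

Lemma biprod_iso A1 A2 S T (i1 : mor A1 S) (i2 : mor A2 S) p1 p2
    (f : mor S T) (g : mor T S) :
  g ∘ f = idm S -> f ∘ g = idm T -> biprod i1 i2 p1 p2 ->
  biprod (f ∘ i1) (f ∘ i2) (p1 ∘ g) (p2 ∘ g).
Proof.
move=> gf fg [e1 e2 e3 e4 e].
have K U V (p : @mor C S U) (i : mor V S) : (p ∘ g) ∘ (f ∘ i) = p ∘ i.
  by rewrite mcompA -(mcompA p) gf mcompm1.
split; rewrite ?K //.
have -> : f ∘ i1 ∘ (p1 ∘ g) + f ∘ i2 ∘ (p2 ∘ g) = f ∘ (i1 ∘ p1 + i2 ∘ p2) ∘ g.
  by rewrite !mcompE.
by rewrite e mcompm1.
Qed.

Lemma kernel_inj A B K (f : mor A B) (k : mor K A) : is_kernel f k -> is_mono k.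
Proof.
move=> [fk kerP] Z g h e.
have [|u [_ uP]] := kerP Z (k ∘ g); first by rewrite mcompA fk mcomp0m.
by rewrite -(uP g) // -(uP h).
Qed.

Lemma cokernel_inj A B Q (f : mor A B) (q : mor B Q) : is_cokernel f q -> is_epi q.
Proof.
move=> [qf cokP] Z g h e.
have [|u [_ uP]] := cokP Z (g ∘ q); first by rewrite -mcompA qf mcompm0.
by rewrite -(uP g) // -(uP h).
Qed.

Lemma is_monoI A B (f : mor A B) :
  (forall Z (g : mor Z A), f ∘ g = 0 -> g = 0) -> is_mono f.
Proof.
move=> f0 Z g h e; apply/eqP; rewrite -subr_eq0; apply/eqP/f0.
by rewrite mcompDr mcompmN e subrr.
Qed.

Lemma is_epiI A B (f : mor A B) :
  (forall Z (g : mor B Z), g ∘ f = 0 -> g = 0) -> is_epi f.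
Proof.
move=> f0 Z g h e; apply/eqP; rewrite -subr_eq0; apply/eqP/f0.
by rewrite mcompDl mcompNm e subrr.
Qed.

Lemma is_kernelI A B K (f : mor A B) (k : mor K A) : f ∘ k = 0 -> is_mono k ->
  (forall Z (g : mor Z A), f ∘ g = 0 -> exists h, k ∘ h = g) -> is_kernel f k.
Proof.
move=> fk km kerP; split=> // Z g /kerP [h kh]; exists h; split=> // h' kh'.
by apply: km; rewrite kh.
Qed.

Lemma is_cokernelI A B Q (f : mor A B) (q : mor B Q) : q ∘ f = 0 -> is_epi q ->
  (forall Z (g : mor B Z), g ∘ f = 0 -> exists h, h ∘ q = g) -> is_cokernel f q.
Proof.
move=> qf qe cokP; split=> // Z g /cokP [h hq]; exists h; split=> // h' hq'.
by apply: qe; rewrite hq.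
Qed.

Lemma pullback_inj B D B' D' (y : mor B D) (f : mor D' D)
    (y' : mor B' D') (f' : mor B' B) : is_pullback y f y' f' ->
  forall Z (u v : mor Z B'), y' ∘ u = y' ∘ v -> f' ∘ u = f' ∘ v -> u = v.
Proof.
move=> [sq pbP] Z u v eu ev.
have [|w [_ wP]] := pbP Z (y' ∘ v) (f' ∘ v); first by rewrite !mcompA sq.
by rewrite -(wP u) // -(wP v).
Qed.

Lemma pushout_inj A B A' B' (x : mor A B) (f : mor A A')
    (x' : mor A' B') (f' : mor B B') : is_pushout x f x' f' ->
  forall Z (u v : mor B' Z), u ∘ x' = v ∘ x' -> u ∘ f' = v ∘ f' -> u = v.
Proof.
move=> [sq poP] Z u v eu ev.
have [|w [_ wP]] := poP Z (v ∘ x') (v ∘ f'); first by rewrite -!mcompA sq.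
by rewrite -(wP u) // -(wP v).
Qed.

(** The normal form f = m ∘ e of a morphism of an abelian category: e is a
    cokernel and m a kernel.  It gives back the axioms: f has the kernel of e
    because m is monic, and when f is monic so is e, which is then the
    cokernel of a zero morphism, hence invertible. *)
Lemma abelian_of_factorizations : additive_cat C ->
  (forall A B (f : @mor C A B), exists I (e : mor A I) (m : mor I B)
     K (k : mor K A) Q (c : mor B Q),
     [/\ f = m ∘ e, is_kernel e k, is_cokernel k e, is_kernel c m
       & is_cokernel m c]) ->
  abelian_cat C.
Proof.
move=> addC fact; split=> // A B f;
  have [I [e [m [K [k [Q [c [-> kerE cokK kerC cokM]]]]]]]] := fact A B f;
  have [em mm] := (cokernel_inj cokK, kernel_inj kerC).
- exists K, k; apply: is_kernelI; first by rewrite -mcompA kerE.1 mcompm0.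
    exact: kernel_inj kerE.
  move=> Z g eg; have /kerE.2 [h [<- _]] : e ∘ g = 0.
    by apply: mm; rewrite mcompA eg mcompm0.
  by exists h.
- exists Q, c; apply: is_cokernelI; first by rewrite mcompA cokM.1 mcomp0m.
    exact: cokernel_inj cokM.
  move=> Z g ge; have /cokM.2 [h [<- _]] : g ∘ m = 0.
    by apply: em; rewrite -mcompA ge mcomp0m.
  by exists h.
- move=> fm; have k0 : k = 0.
    by apply: fm; rewrite -mcompA kerE.1 !mcompm0.
  have [|e' [e'e _]] := cokK.2 _ (idm A); first by rewrite k0 mcompm0.
  exists Q, c; apply: is_kernelI => //; first by rewrite mcompA kerC.1 mcomp0m.
  move=> Z g /kerC.2 [h [<- _]]; exists (e' ∘ h); rewrite mcompA -(mcompA m).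
  suff -> : e ∘ e' = idm I by rewrite mcompm1.
  by apply: em; rewrite -mcompA e'e mcomp1m mcompm1.
- move=> fe; have c0 : c = 0.
    by apply: fe; rewrite mcompA cokM.1 !mcomp0m.
  have [|m' [mm' _]] := kerC.2 _ (idm B); first by rewrite c0 mcomp0m.
  exists K, k; apply: is_cokernelI => //; first by rewrite -mcompA cokK.1 mcompm0.
  move=> Z g /cokK.2 [h [<- _]]; exists (h ∘ m'); rewrite mcompA -(mcompA h).
  suff -> : m' ∘ m = idm I by rewrite mcompm1.
  by apply: mm; rewrite mcompA mm' mcomp1m mcompm1.
Qed.

End Preadditive.

(** * Exact categories *)

Section ExactCategory.
Variables (C : preadd) (conf : conf_class C).
Hypothesis ex : exact_category conf.
Implicit Types A B D Z S : C.

Let confK A B D (x : mor A B) (y : mor B D) (c : conf x y) := exact_kernel ex c.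
Let confQ A B D (x : mor A B) (y : mor B D) (c : conf x y) := exact_cokernel ex c.

Lemma conf_comp0 A B D (x : mor A B) (y : mor B D) : conf x y -> y ∘ x = 0.
Proof. by move=> /confK []. Qed.

Lemma conf_mono A B D (x : mor A B) (y : mor B D) : conf x y -> is_mono x.
Proof. by move=> /confK; apply: kernel_inj. Qed.

Lemma conf_epi A B D (x : mor A B) (y : mor B D) : conf x y -> is_epi y.
Proof. by move=> /confQ; apply: cokernel_inj. Qed.

Lemma conf_lift A B D (x : mor A B) (y : mor B D) : conf x y ->
  forall Z (g : mor Z B), y ∘ g = 0 -> exists h, x ∘ h = g.
Proof. by move=> /confK [_ kerP] Z g /kerP [h [e _]]; exists h. Qed.

Lemma conf_colift A B D (x : mor A B) (y : mor B D) : conf x y ->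
  forall Z (g : mor B Z), g ∘ x = 0 -> exists h, h ∘ y = g.
Proof. by move=> /confQ [_ cokP] Z g /cokP [h [e _]]; exists h. Qed.

Lemma conf_of_kernel A B D A' (x : mor A B) (y : mor B D) (x' : mor A' B) :
  conf x y -> is_kernel y x' -> conf x' y.
Proof.
move=> c k'; have [u xu] := conf_lift c k'.1.
have [v [x'v _]] := k'.2 _ _ (conf_comp0 c).
have iv : is_iso v.
  exists u; split; [apply: (conf_mono c) | apply: (kernel_inj k')].
    by rewrite mcompA xu x'v mcompm1.
  by rewrite mcompA x'v xu mcompm1.
by apply: (exact_isoclosed ex iv (is_iso_id _) (is_iso_id _)) c;
  rewrite ?mcomp1m ?mcompm1.
Qed.

Lemma conf_of_cokernel A B D D' (x : mor A B) (y : mor B D) (y' : mor B D') :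
  conf x y -> is_cokernel x y' -> conf x y'.
Proof.
move=> c k'; have [u uy] := conf_colift c k'.1.
have [v [vy' _]] := k'.2 _ _ (conf_comp0 c).
have iu : is_iso u.
  exists v; split; [apply: (conf_epi c) | apply: (cokernel_inj k')].
    by rewrite -mcompA uy vy' mcomp1m.
  by rewrite -mcompA vy' uy mcomp1m.
by apply: (exact_isoclosed ex (is_iso_id _) (is_iso_id _) iu) c;
  rewrite ?mcomp1m ?mcompm1.
Qed.

Lemma deflation_pullback B D B' D' (y : mor B D) (f : mor D' D)
    (y' : mor B' D') (f' : mor B' B) :
  deflation conf y -> is_pullback y f y' f' -> deflation conf y'.
Proof.
move=> dy pb; have [P [q [g [pb' [K [k c]]]]]] := exact_pullback ex f dy.
have [|u [[qu gu] _]] := pb'.2 _ y' f'; first exact: pb.1.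
have [|v [[y'v f'v] _]] := pb.2 _ q g; first exact: pb'.1.
have iv : is_iso v.
  exists u; split; [apply: (pullback_inj pb') | apply: (pullback_inj pb)];
  by rewrite mcompA ?qu ?gu ?y'v ?f'v ?mcompm1.
exists K, (v ∘ k).
by apply: (exact_isoclosed ex (is_iso_id _) iv (is_iso_id _)) c;
  rewrite ?mcomp1m ?mcompm1.
Qed.

(** A deflation and its pullback have the same kernel: x lifts to the pullback
    as (0, x).  Dually for pushouts of inflations. *)
Lemma conf_pullback A B D D' (x : mor A B) (y : mor B D) (f : mor D' D) :
  conf x y -> exists P (x' : mor A P) (y' : mor P D') (f' : mor P B),
    [/\ conf x' y', is_pullback y f y' f' & f' ∘ x' = x].
Proof.
move=> c; have [|P [y' [f' [pb [K [k c']]]]]] := exact_pullback ex (y := y) f.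
  by exists A, x.
have [|x' [[y'x' f'x'] _]] := pb.2 _ (0 : mor A D') x.
  by rewrite mcompm0 (conf_comp0 c).
exists P, x', y', f'; split=> //; apply: (conf_of_kernel c').
apply: is_kernelI => //.
  by move=> Z g h e; apply: (conf_mono c); rewrite -f'x' -!mcompA e.
move=> Z g y'g; have [|h xh] := conf_lift c (g := f' ∘ g).
  by rewrite mcompA -pb.1 -mcompA y'g mcompm0.
exists h; apply: (pullback_inj pb); rewrite mcompA ?f'x' //.
by rewrite y'x' mcomp0m.
Qed.

Lemma conf_pushout A B D A' (x : mor A B) (y : mor B D) (f : mor A A') :
  conf x y -> exists P (x' : mor A' P) (y' : mor P D) (f' : mor B P),
    [/\ conf x' y', is_pushout x f x' f' & y' ∘ f' = y].
Proof.
move=> c; have [|P [x' [f' [po [K [k c']]]]]] := exact_pushout ex (x := x) f.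
  by exists D, y.
have [|y' [[y'x' y'f'] _]] := po.2 _ (0 : mor A' D) y.
  by rewrite mcomp0m (conf_comp0 c).
exists P, x', y', f'; split=> //; apply: (conf_of_cokernel c').
apply: is_cokernelI => //.
  by move=> Z g h e; apply: (conf_epi c); rewrite -y'f' !mcompA e.
move=> Z g gx'; have [|h hy] := conf_colift c (g := g ∘ f').
  by rewrite -mcompA -po.1 mcompA gx' mcomp0m.
exists h; apply: (pushout_inj po); rewrite -mcompA ?y'f' //.
by rewrite y'x' mcompm0.
Qed.

Lemma conf_0id Z A : zero_object Z -> conf (0 : mor Z A) (idm A).
Proof.
move=> Z0; have [K [x c]] := exact_defl_id ex A.
apply: (conf_of_kernel c); apply: is_kernelI; first by rewrite mcompm0.
  by move=> W g h _; rewrite ((Z0 W).1 g) ((Z0 W).1 h).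
by move=> W g; rewrite mcomp1m => ->; exists 0; rewrite mcompm0.
Qed.

Lemma conf_id0 A Z : zero_object Z -> conf (idm A) (0 : mor A Z).
Proof.
move=> Z0; have [K [x c]] := exact_infl_id ex A.
apply: (conf_of_cokernel c); apply: is_cokernelI; first by rewrite mcomp0m.
  by move=> W g h _; rewrite ((Z0 W).2 g) ((Z0 W).2 h).
by move=> W g; rewrite mcompm1 => ->; exists 0; rewrite mcomp0m.
Qed.

Lemma biprod_kernel A B S (i1 : mor A S) (i2 : mor B S) p1 p2 :
  biprod i1 i2 p1 p2 -> is_kernel p2 i1.
Proof.
move=> [e1 e2 e3 e4 e]; apply: is_kernelI => // Z.
  by move=> g h egh; rewrite -[g]mcomp1m -[h]mcomp1m -e1 -!mcompA egh.
move=> g pg; exists (p1 ∘ g).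
by rewrite -[RHS]mcomp1m -e mcompDl -!mcompA pg mcompm0 addr0.
Qed.

(** A biproduct is the pullback of A -> 0 along B -> 0. *)
Lemma conf_split A B S (i1 : mor A S) (i2 : mor B S) p1 p2 :
  biprod i1 i2 p1 p2 -> conf i1 p2.
Proof.
move=> bp; have [[Z Z0] _] := exact_additive ex.
have [||K [k c]] := @deflation_pullback A Z S B 0 0 p2 p1.
- by exists A, (idm A); apply: conf_id0.
- split=> [|W u v _]; first by rewrite !mcomp0m.
  exists (i1 ∘ v + i2 ∘ u); split=> [|w [<- <-]]; first by rewrite !(mcompE, biprodE bp).
  by apply: (biprod_eq_out bp); rewrite !(mcompE, biprodE bp).
exact: conf_of_kernel c (biprod_kernel bp).
Qed.

(** A direct sum of conflations is one: its deflation is the composite of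
    B ⊕ B' -> D ⊕ B' -> D ⊕ D', both of which are pullbacks of the given
    deflations. *)
Lemma conf_sum A B D A' B' D' (x : mor A B) (y : mor B D)
    (x' : mor A' B') (y' : mor B' D')
    SA (iA : mor A SA) (iA' : mor A' SA) pA pA'
    SB (iB : mor B SB) (iB' : mor B' SB) pB pB'
    SD (iD : mor D SD) (iD' : mor D' SD) pD pD' :
  biprod iA iA' pA pA' -> biprod iB iB' pB pB' -> biprod iD iD' pD pD' ->
  conf x y -> conf x' y' ->
  conf (iB ∘ x ∘ pA + iB' ∘ x' ∘ pA') (iD ∘ y ∘ pB + iD' ∘ y' ∘ pB').
Proof.
move=> bA bB bD c c'.
have [T [j1 [j2 [q1 [q2 bT]]]]] := (exact_additive ex).2 D B'.
have bE := (biprodE bA, biprodE bB, biprodE bD, biprodE bT).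
have dy1 : deflation conf (j1 ∘ y ∘ pB + j2 ∘ pB').
  apply: (@deflation_pullback _ _ _ _ y q1 _ pB); first by exists A, x.
  split=> [|W u v e]; first by rewrite !(mcompE, bE).
  exists (iB ∘ v + iB' ∘ q2 ∘ u); split=> [|w [<- <-]]; last first.
    by apply: (biprod_eq_out bB); rewrite !(mcompE, bE).
  split; last by rewrite !(mcompE, bE).
  by apply: (biprod_eq_out bT); rewrite !(mcompE, bE).
have dy2 : deflation conf (iD ∘ q1 + iD' ∘ y' ∘ q2).
  apply: (@deflation_pullback _ _ _ _ y' pD' _ q2); first by exists A', x'.
  split=> [|W u v e]; first by rewrite !(mcompE, bE).
  exists (j1 ∘ pD ∘ u + j2 ∘ v); split=> [|w [<- <-]]; last first.
    by apply: (biprod_eq_out bT); rewrite !(mcompE, bE).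
  split; last by rewrite !(mcompE, bE).
  by apply: (biprod_eq_out bD); rewrite !(mcompE, bE).
have [K [k ck]] := exact_defl_comp ex dy1 dy2.
have ey : (iD ∘ q1 + iD' ∘ y' ∘ q2) ∘ (j1 ∘ y ∘ pB + j2 ∘ pB') =
    iD ∘ y ∘ pB + iD' ∘ y' ∘ pB' by rewrite !(mcompE, bE).
rewrite ey in ck; apply: (conf_of_kernel ck); apply: is_kernelI.
- by rewrite !(mcompE, bE) (mcomp_eql (conf_comp0 c)) (mcomp_eql (conf_comp0 c')) !mcompE.
- move=> Z g h e; apply: (biprod_eq_out bA).
    apply: (conf_mono c); have := congr1 (mcomp pB) e.
    by rewrite !(mcompE, bE).
  apply: (conf_mono c'); have := congr1 (mcomp pB') e.
  by rewrite !(mcompE, bE).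
move=> Z g e.
have [|h xh] := conf_lift c (g := pB ∘ g).
  by have := congr1 (mcomp pD) e; rewrite !(mcompE, bE).
have [|h' xh'] := conf_lift c' (g := pB' ∘ g).
  by have := congr1 (mcomp pD') e; rewrite !(mcompE, bE).
exists (iA ∘ h + iA' ∘ h').
by apply: (biprod_eq_out bB); rewrite !(mcompE, bE).
Qed.

End ExactCategory.

(** * Conflations and split conflations *)

Section ConflationCategory.
Variables (C : preadd) (conf : conf_class C).
Hypothesis ex : exact_category conf.
Local Notation cf := (confcat conf).
Implicit Types P Q R : cf.

Lemma chE1 P Q (t : mor P Q) : cof Q ∘ chom1 t = chom2 t ∘ cof P.
Proof. by have /andP[/eqP e _] := valP t. Qed.

Lemma chE2 P Q (t : mor P Q) : cog Q ∘ chom2 t = chom3 t ∘ cog P.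
Proof. by have /andP[_ /eqP e] := valP t. Qed.

Lemma ch_ofP P Q (f1 : mor (co1 P) (co1 Q)) (f2 : mor (co2 P) (co2 Q))
    (f3 : mor (co3 P) (co3 Q)) :
  cof Q ∘ f1 = f2 ∘ cof P -> cog Q ∘ f2 = f3 ∘ cog P ->
  exists t : mor P Q, [/\ chom1 t = f1, chom2 t = f2 & chom3 t = f3].
Proof.
move=> e1 e2; have t : ((f1, f2), f3) \in @commutes _ _ P Q.
  by rewrite unfold_in /commutes /= e1 e2 !eqxx.
by exists (Confhom t).
Qed.

Lemma ch_of_right P Q (f2 : mor (co2 P) (co2 Q)) (f3 : mor (co3 P) (co3 Q)) :
  cog Q ∘ f2 = f3 ∘ cog P ->
  exists t : mor P Q, chom2 t = f2 /\ chom3 t = f3.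
Proof.
move=> e; have [|f1 e1] := conf_lift ex (cofgP Q) (g := f2 ∘ cof P).
  by rewrite mcompA e (mcomp_eql (conf_comp0 ex (cofgP P))) mcompm0.
by have [t [_ ? ?]] := ch_ofP e1 e; exists t.
Qed.

Lemma ch_of_left P Q (f1 : mor (co1 P) (co1 Q)) (f2 : mor (co2 P) (co2 Q)) :
  cof Q ∘ f1 = f2 ∘ cof P ->
  exists t : mor P Q, chom1 t = f1 /\ chom2 t = f2.
Proof.
move=> e; have [|f3 e3] := conf_colift ex (cofgP P) (g := cog Q ∘ f2).
  by rewrite -mcompA -e mcompA (conf_comp0 ex (cofgP Q)) mcomp0m.
by have [t [? ? _]] := ch_ofP e (esym e3); exists t.
Qed.

Lemma chom1M P Q R (t : mor Q R) (u : mor P Q) : chom1 (t ∘ u) = chom1 t ∘ chom1 u.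
Proof. by []. Qed.
Lemma chom2M P Q R (t : mor Q R) (u : mor P Q) : chom2 (t ∘ u) = chom2 t ∘ chom2 u.
Proof. by []. Qed.
Lemma chom3M P Q R (t : mor Q R) (u : mor P Q) : chom3 (t ∘ u) = chom3 t ∘ chom3 u.
Proof. by []. Qed.

Lemma chom1D P Q (t u : mor P Q) : chom1 (t + u) = chom1 t + chom1 u.
Proof. by []. Qed.
Lemma chom2D P Q (t u : mor P Q) : chom2 (t + u) = chom2 t + chom2 u.
Proof. by []. Qed.
Lemma chom3D P Q (t u : mor P Q) : chom3 (t + u) = chom3 t + chom3 u.
Proof. by []. Qed.
Lemma chom3_sum P Q k (t : 'I_k -> mor P Q) :
  chom3 (\sum_(j < k) t j) = \sum_(j < k) chom3 (t j).
Proof. exact: (big_morph (fun t : mor P Q => chom3 t)). Qed.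

Lemma biprod_of_section A B D (x : mor A B) (y : mor B D) (s : mor D B) :
  conf x y -> y ∘ s = idm D -> exists r, biprod x s r y.
Proof.
move=> c ys; have [|r xr] := conf_lift ex c (g := idm B - s ∘ y).
  by rewrite !mcompE ys mcomp1m subrr.
exists r; split=> //; last by rewrite xr addrNK.
- apply: (conf_mono ex c); rewrite mcompA xr !mcompE -mcompA (conf_comp0 ex c).
  by rewrite !mcompE.
- apply: (conf_mono ex c); rewrite mcompA xr !mcompE -mcompA ys.
  by rewrite mcompm1 subrr.
exact: conf_comp0 c.
Qed.

Lemma biprod_of_retraction A B D (x : mor A B) (y : mor B D) (r : mor B A) :
  conf x y -> r ∘ x = idm A -> exists s, biprod x s r y.
Proof.
move=> c rx; have [|s sy] := conf_colift ex c (g := idm B - x ∘ r).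
  by rewrite !mcompE -mcompA rx mcompm1 subrr.
exists s; split=> //; last by rewrite sy addrC addrNK.
- apply: (conf_epi ex c); rewrite -mcompA sy !mcompE (conf_comp0 ex c).
  by rewrite !mcompE.
- apply: (conf_epi ex c); rewrite -mcompA sy !mcompE rx mcomp1m.
  by rewrite subrr.
exact: conf_comp0 c.
Qed.

Lemma split_of_section P s : cog P ∘ s = idm (co3 P) -> split_conflation P.
Proof. by move=> /(biprod_of_section (cofgP P)) [r bp]; exists s, r. Qed.

Lemma split_of_retraction P r : r ∘ cof P = idm (co1 P) -> split_conflation P.
Proof. by move=> /(biprod_of_retraction (cofgP P)) [s bp]; exists s, r. Qed.

(** Every conflation P embeds into the split conflation
    co2 P -> co2 P ⊕ co3 P -> co3 P, whose quotient by P is co3 P = co3 P -> 0;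
    a morphism out of P extends along this embedding as soon as its first
    component extends along cof P. *)
Lemma split_hull P : exists S T (a : mor P S) (b : mor S T),
  [/\ degreewise a b, split_conflation S, split_conflation T
    & forall Q (f : mor P Q) k, chom1 f = k ∘ cof P ->
      exists g : mor S Q, f = g ∘ a].
Proof.
have yx := conf_comp0 ex (cofgP P).
have [[Z Z0] bps] := exact_additive ex.
have [B [i1 [i2 [p1 [p2 bp]]]]] := bps (co2 P) (co3 P).
pose S : cf := Confob (conf_split ex bp).
pose T : cf := Confob (conf_id0 ex (co3 P) Z0).
have [||a [a1 a2 a3]] := @ch_ofP P S (cof P) (i1 + i2 ∘ cog P) (idm _).
- by rewrite /= mcompDl -mcompA yx !mcompE.
- by rewrite /= !(mcompE, biprodE bp).
have [||b [b1 b2 b3]] := @ch_ofP S T (cog P) (cog P ∘ p1 - p2) 0.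
- by rewrite /= !(mcompE, biprodE bp).
- by rewrite /= !mcompE.
exists S, T, a, b; split.
- split; rewrite ?a1 ?a2 ?a3 ?b1 ?b2 ?b3; first exact: cofgP.
  + apply: (@conf_split _ _ ex _ _ _ _ (- i2) p1); split;
      rewrite !(mcompE, biprodE bp) ?oppr0 ?opprK ?subrr ?addr0 //.
    by rewrite addrA addrK (biprod_sum bp).
  exact: conf_id0.
- by exists i2, p1.
- by exists 0, (idm _); apply: biprod_zero.
move=> Q f k f1k.
(* h : co3 P -> co2 Q is the other half of the homotopy started by k. *)
have [|h hy] := conf_colift ex (cofgP P) (g := chom2 f - cof Q ∘ k).
  by rewrite !mcompE -chE1 f1k mcompA subrr.
have [||g [g1 g2 g3]] := @ch_ofP S Q k (cof Q ∘ k ∘ p1 + h ∘ p2) (chom3 f).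
- by rewrite /= !(mcompE, biprodE bp).
- rewrite /= !mcompE (conf_comp0 ex (cofgP Q)) !mcompE; congr (_ ∘ _).
  apply: (conf_epi ex (cofgP P)); rewrite -mcompA hy !mcompE.
  by rewrite (conf_comp0 ex (cofgP Q)) !mcompE chE2.
exists g; apply: confhom_eq; rewrite ?(chom1M, chom2M, chom3M).
- by rewrite g1 a1.
- rewrite g2 a2 !(mcompE, biprodE bp) hy.
  by rewrite addrC addrNK.
by rewrite g3 a3 mcompm1.
Qed.

(** Dually, P is the quotient of co1 P -> co1 P ⊕ co2 P -> co2 P by
    0 -> co1 P = co1 P. *)
Lemma split_cover P : exists S T (a : mor T S) (b : mor S P),
  [/\ degreewise a b, split_conflation S, split_conflation T
    & forall Q (f : mor Q P) h, chom3 f = cog P ∘ h ->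
      exists g : mor Q S, f = b ∘ g].
Proof.
have yx := conf_comp0 ex (cofgP P).
have [[Z Z0] bps] := exact_additive ex.
have [B [i1 [i2 [p1 [p2 bp]]]]] := bps (co1 P) (co2 P).
pose S : cf := Confob (conf_split ex bp).
pose T : cf := Confob (conf_0id ex (co1 P) Z0).
have [||b [b1 b2 b3]] := @ch_ofP S P (idm _) (cof P ∘ p1 + p2) (cog P).
- by rewrite /= !(mcompE, biprodE bp).
- by rewrite /= !mcompE yx !mcompE.
have [||a [a1 a2 a3]] := @ch_ofP T S 0 (i2 ∘ cof P - i1) (cof P).
- by rewrite /= !mcompE.
- by rewrite /= !(mcompE, biprodE bp).
exists S, T, a, b; split.
- split; rewrite ?a1 ?a2 ?a3 ?b1 ?b2 ?b3; last exact: cofgP.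
  + exact: conf_0id.
  apply: (@conf_split _ _ ex _ _ _ _ i2 (- p1)); split;
    rewrite !(mcompE, biprodE bp) ?oppr0 ?opprK ?subrr ?addr0 ?sub0r ?opprK ?add0r //.
  + by rewrite addrC subrr.
  by rewrite addrACA addNr add0r (biprod_sum bp).
- by exists i2, p1.
- exists (idm _), 0; apply: biprodC; exact: biprod_zero.
move=> Q f h f3h.
have [|k xk] := conf_lift ex (cofgP P) (g := chom2 f - h ∘ cog Q).
  by rewrite !mcompE chE2 f3h subrr.
have [||g [g1 g2 g3]] := @ch_ofP Q S (chom1 f) (i1 ∘ k + i2 ∘ h ∘ cog Q) h.
- rewrite /= mcompDl -!mcompA (conf_comp0 ex (cofgP Q)) !mcompE -mcompA.
  congr (_ ∘ _); apply: (conf_mono ex (cofgP P)); rewrite mcompA xk chE1.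
  by rewrite !mcompE -mcompA (conf_comp0 ex (cofgP Q)) !mcompE.
- by rewrite /= !(mcompE, biprodE bp).
exists g; apply: confhom_eq; rewrite ?(chom1M, chom2M, chom3M).
- by rewrite g1 b1 mcomp1m.
- rewrite g2 b2 !(mcompE, biprodE bp) xk.
  by rewrite addrNK.
by rewrite g3 b3.
Qed.

(** A direct summand of a coproduct of split conflations inherits a section
    of its deflation. *)
Lemma split_conflation_addc P :
  split_conflation P <-> addc (split_conflation (conf := conf)) P.
Proof.
split=> [sP | [k [F [Q [sF [i_ [p_ [pi1 pi0 ip]]] [P' [i1 [i2 [p1 [p2 bp]]]]]]]]]].
  have [[Z Z0] _] := exact_additive ex.
  pose O : cf := Confob (conf_id0 ex Z Z0).
  have O0 : zero_object O.
    by apply: zero_of_id; apply: confhom_eq; rewrite [LHS](Z0 _).1 [RHS](Z0 _).1.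
  exists 1%N, (fun=> P), P; split=> //; last first.
    by exists O, (idm P), 0, (idm P), 0; apply: biprod_zero.
  exists (fun=> idm P), (fun=> idm P).
  split=> [j|j l|]; rewrite ?big_ord1 ?mcompm1 //.
  by rewrite (ord1 j) (ord1 l).
have /fin_all_exists [s sP] j : exists s, cog (F j) ∘ s = idm (co3 (F j)).
  by have [s [r bpj]] := sF j; exists s; apply: biprod_p2i2 bpj.
pose sQ := \sum_(j < k) chom2 (i_ j) ∘ s j ∘ chom3 (p_ j).
have sQP : cog Q ∘ sQ = idm _.
  rewrite mcomp_sumr -[RHS](congr1 (fun t : mor Q Q => chom3 t) ip) chom3_sum.
  by apply: eq_bigr => j _; rewrite !mcompA chE2 (mcomp_eql (sP j)) mcompm1.
apply: (@split_of_section _ (chom2 p1 ∘ sQ ∘ chom3 i1)).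
rewrite !mcompA chE2 (mcomp_eql sQP) mcompm1.
by rewrite -chom3M (biprod_p1i1 bp).
Qed.

(** A morphism from P to a split conflation has a first component that extends
    along cof P, since the inflation of its target has a retraction; so the
    embedding of [split_hull] is a preenvelope.  Dually for precovers. *)
Theorem split_pseudo_cluster_tilting :
  pseudo_cluster_tilting (degreewise (conf := conf)) (split_conflation (conf := conf)).
Proof.
split=> [P|P|P]; first exact: split_conflation_addc.
- have [S [T [a [b [c sS sT ext]]]]] := split_hull P.
  exists S, T, a, b; split=> // Q f [s [r bp]]; apply: (ext _ _ (r ∘ chom2 f)).
  by rewrite -mcompA -chE1 mcompA (biprod_p1i1 bp) mcomp1m.
- have [S [T [a [b [c sS sT lft]]]]] := split_cover P.
  exists T, S, a, b; split=> // Q f [s [r bp]]; apply: (lft _ _ (chom2 f ∘ s)).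
  by rewrite mcompA chE2 (mcomp_eql (biprod_p2i2 bp)) mcompm1.
Qed.

Lemma pseudo_cluster_tilting_resolutions (D : preadd) (cD : conf_class D)
    (S : D -> Prop) : pseudo_cluster_tilting cD S ->
  forall A, wedge cD S 1 A /\ vee cD S 1 A.
Proof.
move=> [_ hull cover] A; split; exists 1%N; split=> //.
  have [D1 [D0 [a [b [c S0 S1 _]]]]] := cover A.
  exists (fun i => if i is 0 then A else D1), (fun i => if i is 0 then D0 else D1).
  split=> [|[|i]|[]// _|] //; first by exists a, b.
  by exists (idm D1); apply: is_iso_id.
have [D0 [D1 [a [b [c S0 S1 _]]]]] := hull A.
exists (fun i => if i is 0 then A else D1), (fun i => if i is 0 then D0 else D1).
split=> [|[|i]|[]// _|] //; first by exists a, b.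
by exists (idm D1); apply: is_iso_id.
Qed.

(** A morphism of conflations factors through split ones iff it is
    null-homotopic.  A homotopy has two components, co3 P -> co2 Q and
    co2 P -> co1 Q, and each of them determines the other. *)
Lemma factors_split3 P Q (f : mor P Q) :
  factors (split_conflation (conf := conf)) f <->
  exists h, chom3 f = cog Q ∘ h.
Proof.
split=> [[k [Z [h [g [sZ ->]]]]]|[h f3]]; last first.
  have [S [T [a [b [_ sS _ lft]]]]] := split_cover Q.
  have [g ->] := lft _ _ _ f3.
  by exists 1%N, (fun=> S), (fun=> b), (fun=> g); rewrite big_ord1.
have /fin_all_exists [s sP] j : exists s, cog (Z j) ∘ s = idm (co3 (Z j)).
  by have [s [r bpj]] := sZ j; exists s; apply: biprod_p2i2 bpj.
exists (\sum_(j < k) chom2 (h j) ∘ s j ∘ chom3 (g j)).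
rewrite mcomp_sumr chom3_sum.
by apply: eq_bigr => j _; rewrite !mcompA chE2 (mcomp_eql (sP j)) mcompm1.
Qed.

Lemma factors_split1 P Q (f : mor P Q) :
  factors (split_conflation (conf := conf)) f <->
  exists k, chom1 f = k ∘ cof P.
Proof.
split=> [/factors_split3 [h f3]|[k f1]]; last first.
  have [S [T [a [b [_ sS _ ext]]]]] := split_hull P.
  have [g ->] := ext _ _ _ f1.
  by exists 1%N, (fun=> S), (fun=> g), (fun=> a); rewrite big_ord1.
have [|k xk] := conf_lift ex (cofgP Q) (g := chom2 f - h ∘ cog P).
  by rewrite !mcompE chE2 f3 subrr.
exists k; apply: (conf_mono ex (cofgP Q)); rewrite mcompA xk !mcompE chE1.
by rewrite -(mcompA h) (conf_comp0 ex (cofgP P)) !mcompE.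
Qed.

End ConflationCategory.

(** * The category of conflations modulo split ones is abelian *)

Lemma fullsub_additive (C : preadd) (P : C -> Prop) : additive_cat C ->
  (forall Z, zero_object Z -> P Z) ->
  (forall A B S i1 i2 p1 p2, @biprod C A B S i1 i2 p1 p2 -> P A -> P B -> P S) ->
  additive_cat (fullsub P).
Proof.
move=> [[Z Z0] bps] P0 PD; split.
  by exists (exist _ Z (P0 _ Z0)) => A; apply: (Z0 (sval A)).
move=> A B; have [S [i1 [i2 [p1 [p2 bp]]]]] := bps (sval A) (sval B).
exists (exist _ S (PD _ _ _ _ _ _ _ bp (svalP A) (svalP B))), i1, i2, p1, p2.
by case: bp.
Qed.

Section QuotientCategory.
Variables (C : preadd) (J : ideal C).
Local Notation "[ 'q' f ]" := (qcls J f : @mor (quotcat J) _ _) (at level 0).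

Lemma qclsM A B D (g : @mor C B D) (f : mor A B) : [q g ∘ f] = [q g] ∘ [q f].
Proof. by rewrite /= qcompE. Qed.

Lemma qcls0 A B : [q (0 : @mor C A B)] = 0.
Proof. by apply: (addrI [q 0]); rewrite -qclsD !addr0. Qed.

Lemma qcls_eq0 A B (f : @mor C A B) : [q f] = 0 <-> imem J f.
Proof. by rewrite -qcls0 qclsP subr0. Qed.

Lemma quotcat_biprod A1 A2 S (i1 : @mor C A1 S) (i2 : @mor C A2 S) p1 p2 :
  biprod i1 i2 p1 p2 -> biprod [q i1] [q i2] [q p1] [q p2].
Proof.
case=> e1 e2 e3 e4 e.
by split; rewrite -!qclsM -?qclsD ?e ?e1 ?e2 ?e3 ?e4 ?qcls0.
Qed.

Lemma quotcat_zero Z : @zero_object C Z -> @zero_object (quotcat J) Z.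
Proof.
move=> Z0; apply: zero_of_id; rewrite /= -qcls0; congr (qcls J _).
exact: (Z0 _).1.
Qed.

Lemma quotcat_additive : additive_cat C -> additive_cat (quotcat J).
Proof.
move=> [[Z Z0] bps]; split; first by exists Z; apply: quotcat_zero.
move=> A B; have [S [i1 [i2 [p1 [p2 bp]]]]] := bps A B.
by exists S, [q i1], [q i2], [q p1], [q p2]; apply: quotcat_biprod.
Qed.

End QuotientCategory.

Section StableConflations.
Variables (C : preadd) (conf : conf_class C).
Hypothesis ex : exact_category conf.
Local Notation cf := (confcat conf).
Local Notation J := (factor_ideal (split_conflation (conf := conf))).
Local Notation "[ 'q' f ]" := (qcls J f : @mor (quotcat J) _ _) (at level 0).

Lemma stable_eq3 (P Q : cf) (f g : mor P Q) :
  [q f] = [q g] <-> exists h, chom3 f - chom3 g = cog Q ∘ h.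
Proof. by rewrite qclsP; apply: (factors_split3 ex (f - g)). Qed.

Lemma stable_eq1 (P Q : cf) (f g : mor P Q) :
  [q f] = [q g] <-> exists k, chom1 f - chom1 g = k ∘ cof P.
Proof. by rewrite qclsP; apply: (factors_split1 ex (f - g)). Qed.

Lemma stable_surj (P Q : cf) (f : @mor (quotcat J) P Q) : exists g, f = [q g].
Proof. by exists (qrepr f); rewrite qreprK. Qed.

Lemma stable_eq0_3 (P Q : cf) (f : mor P Q) :
  [q f] = 0 <-> exists h, chom3 f = cog Q ∘ h.
Proof. by rewrite qcls_eq0; apply: (factors_split3 ex f). Qed.

Lemma stable_eq0_1 (P Q : cf) (f : mor P Q) :
  [q f] = 0 <-> exists k, chom1 f = k ∘ cof P.
Proof. by rewrite qcls_eq0; apply: (factors_split1 ex f). Qed.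

(** Modulo split conflations, a morphism into A -> B -> D is determined by its
    component into D, taken modulo the morphisms that lift to B.  If e is the
    identity of D, then e kills those whose component lifts to E; they factor
    uniquely through the pullback of A -> B -> D along z : E -> D. *)
Lemma stable_ker_coker A B D A' E (x : mor A B) (y : mor B D)
    (x' : mor A' E) (z : mor E D) (c : conf x y) (c' : conf x' z)
    (e : @mor cf (Confob c) (Confob c')) : chom3 e = idm D ->
  exists (K : cf) (k : mor K (Confob c)),
    is_kernel [q e] [q k] /\ is_cokernel [q k] [q e].
Proof.
move=> e3; have [V [v [w [g [cv pb gv]]]]] := conf_pullback ex z c.
pose K : cf := Confob cv.
have [|k [k2 k3]] := @ch_of_right _ _ ex K (Confob c) g z; first by rewrite /= pb.1.
have ek0 : [q e] ∘ [q k] = 0.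
  rewrite -qclsM; apply/stable_eq0_3; exists (idm E).
  by rewrite chom3M e3 k3 mcomp1m mcompm1.
exists K, k; split; [apply: is_kernelI => // | apply: is_cokernelI => //].
- apply: is_monoI => T h0; have [t ->] := stable_surj h0.
  rewrite -qclsM => /stable_eq0_3 [u]; rewrite chom3M k3 /= => zt.
  have [s [[ws gs] _]] := pb.2 _ _ _ zt.
  by apply/stable_eq0_3; exists s; rewrite /= ws.
- move=> T h0; have [t ->] := stable_surj h0.
  rewrite -qclsM => /stable_eq0_3 [u]; rewrite chom3M e3 mcomp1m /= => tu.
  have [|s [[ws gs] _]] := pb.2 _ (u ∘ cog T) (chom2 t).
    by rewrite mcompA -tu; apply: esym (chE2 t).
  have [|r [r2 r3]] := @ch_of_right _ _ ex T K s u; first by rewrite /= ws.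
  exists [q r]; rewrite /= qcompE; apply/stable_eq3; exists 0.
  by rewrite chom3M k3 r3 -tu subrr mcompm0.
- apply: is_epiI => T h0; have [t ->] := stable_surj h0.
  rewrite -qclsM => /stable_eq0_3 [u]; rewrite chom3M e3 mcompm1 => tu.
  by apply/stable_eq0_3; exists u.
move=> T h0; have [t ->] := stable_surj h0.
rewrite -qclsM => /stable_eq0_3 [u]; rewrite chom3M k3 => tu.
have [|r [r2 r3]] := @ch_of_right _ _ ex (Confob c') T u (chom3 t).
  by rewrite /= tu.
exists [q r]; rewrite /= qcompE; apply/stable_eq3; exists 0.
by rewrite chom3M e3 r3 mcompm1 subrr mcompm0.
Qed.

(** The dual statement, for a morphism m that is the identity on the first
    terms: its cokernel is the pushout of the target along the inflation of the
    source. *)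
Lemma stable_coker_ker A E D B' D' (x : mor A E) (z : mor E D)
    (x' : mor A B') (y' : mor B' D') (c : conf x z) (c' : conf x' y')
    (m : @mor cf (Confob c) (Confob c')) : chom1 m = idm A ->
  exists (K : cf) (k : @mor cf (Confob c') K),
    is_kernel [q k] [q m] /\ is_cokernel [q m] [q k].
Proof.
move=> m1; have [V [v [w [g [cv po gw]]]]] := conf_pushout ex x c'.
pose K : cf := Confob cv.
have [|k [k1 k2]] := @ch_of_left _ _ ex (Confob c') K x g; first by rewrite /= po.1.
have km0 : [q k] ∘ [q m] = 0.
  rewrite -qclsM; apply/stable_eq0_1; exists (idm E).
  by rewrite chom1M m1 k1 mcomp1m mcompm1.
exists K, k; split; [apply: is_kernelI => // | apply: is_cokernelI => //].
- apply: is_monoI => T h0; have [t ->] := stable_surj h0.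
  rewrite -qclsM => /stable_eq0_1 [u]; rewrite chom1M m1 mcomp1m => tu.
  by apply/stable_eq0_1; exists u.
- move=> T h0; have [t ->] := stable_surj h0.
  rewrite -qclsM => /stable_eq0_1 [u]; rewrite chom1M k1 => tu.
  have [|r [r1 r2]] := @ch_of_left _ _ ex T (Confob c) (chom1 t) u.
    by rewrite /= tu.
  exists [q r]; rewrite /= qcompE; apply/stable_eq1; exists 0.
  by rewrite chom1M m1 r1 mcomp1m subrr mcomp0m.
- apply: is_epiI => T h0; have [t ->] := stable_surj h0.
  rewrite -qclsM => /stable_eq0_1 [u]; rewrite chom1M k1 /= => tu.
  have [s [[sv sg] _]] := po.2 _ _ _ tu.
  by apply/stable_eq0_1; exists s; rewrite /= sv.
move=> T h0; have [t ->] := stable_surj h0.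
rewrite -qclsM => /stable_eq0_1 [u]; rewrite chom1M m1 mcompm1 /= => tu.
have [|s [[sv sg] _]] := po.2 _ (cof T ∘ u) (chom2 t).
  by rewrite -mcompA -tu; apply: chE1 t.
have [|r [r1 r2]] := @ch_of_left _ _ ex K T u s; first by rewrite /= sv.
exists [q r]; rewrite /= qcompE; apply/stable_eq1; exists 0.
by rewrite chom1M k1 r1 -tu subrr mcomp0m.
Qed.

Lemma confcat_additive : additive_cat cf.
Proof.
have [[Z Z0] bps] := exact_additive ex; split.
  exists (Confob (conf_id0 ex Z Z0)).
  by apply: zero_of_id; apply: confhom_eq; rewrite [LHS](Z0 _).1 [RHS](Z0 _).1.
move=> P Q.
have [S1 [i1 [j1 [p1 [q1 b1]]]]] := bps (co1 P) (co1 Q).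
have [S2 [i2 [j2 [p2 [q2 b2]]]]] := bps (co2 P) (co2 Q).
have [S3 [i3 [j3 [p3 [q3 b3]]]]] := bps (co3 P) (co3 Q).
have bE := (biprodE b1, biprodE b2, biprodE b3).
pose S : cf := Confob (conf_sum ex b1 b2 b3 (cofgP P) (cofgP Q)).
have [||i [ei1 ei2 ei3]] := @ch_ofP _ _ P S i1 i2 i3.
1,2: by rewrite /= !(mcompE, bE).
have [||j [ej1 ej2 ej3]] := @ch_ofP _ _ Q S j1 j2 j3.
1,2: by rewrite /= !(mcompE, bE).
have [||p [ep1 ep2 ep3]] := @ch_ofP _ _ S P p1 p2 p3.
1,2: by rewrite /= !(mcompE, bE).
have [||q [eq1 eq2 eq3]] := @ch_ofP _ _ S Q q1 q2 q3.
1,2: by rewrite /= !(mcompE, bE).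
exists S, i, j, p, q.
have cE := (chom1M, chom2M, chom3M, ei1, ei2, ei3, ej1, ej2, ej3,
            ep1, ep2, ep3, eq1, eq2, eq3, bE).
split; apply: confhom_eq; rewrite ?(chom1D, chom2D, chom3D) !cE //.
- exact: biprod_sum b1.
- exact: biprod_sum b2.
exact: biprod_sum b3.
Qed.

(** The image of f is the pullback A' -> E -> D of its target A' -> B' -> D'
    along the third component of f: f factors through it as e, the identity on
    the third terms, followed by m, the identity on the first ones. *)
Theorem stable_abelian : abelian_cat (quotcat J).
Proof.
apply: abelian_of_factorizations => [|P Q f0].
  exact: quotcat_additive confcat_additive.
have [f ->] := stable_surj f0.
case: P Q f0 f => [A B D x y c] [A' B' D' x' y' c'] _ f.
have [E [v [w [g [cv pb gv]]]]] := conf_pullback ex (chom3 f : mor D D') c'.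
have [e2 [[we ge] _]] := pb.2 _ y (chom2 f) (esym (chE2 f)).
have sq1 : v ∘ chom1 f = e2 ∘ x.
  apply: (pullback_inj pb); rewrite !mcompA ?gv ?we ?ge ?(chE1 f) //.
  by rewrite (conf_comp0 ex cv) (conf_comp0 ex c) mcomp0m.
have sq2 : w ∘ e2 = idm D ∘ y by rewrite mcomp1m.
have [e [ee1 ee2 ee3]] := @ch_ofP _ _ (Confob c) (Confob cv) _ _ _ sq1 sq2.
have [||m [m1 m2 m3]] := @ch_ofP _ _ (Confob cv) (Confob c') (idm A') g (chom3 f).
- by rewrite /= mcompm1.
- by rewrite /= pb.1.
have [K [k [kerE cokK]]] := stable_ker_coker ee3.
have [Q [q [kerQ cokM]]] := stable_coker_ker m1.
exists (Confob cv), [q e], [q m], K, [q k], Q, [q q]; split=> //.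
rewrite -qclsM; congr (qcls J _).
by apply: confhom_eq; rewrite ?chom1M ?chom2M ?chom3M ?ee1 ?ee2 ?ee3 ?m1 ?m2 ?m3
  ?mcomp1m ?mcompm1.
Qed.

End StableConflations.

(** * Kernels of natural transformations *)

Section Functors.
Variable C : preadd.
Implicit Types F G T : addfun C.

Lemma nattrans_inj F G (a : nattrans F G) :
  (forall Z (x : F Z), ntf a x = 0 -> x = 0) ->
  forall Z (x y : F Z), ntf a x = ntf a y -> x = y.
Proof.
move=> a0 Z x y e; apply/eqP; rewrite -subr_eq0; apply/eqP/a0.
by apply: (addIr (ntf a y)); rewrite -ntD subrK add0r.
Qed.

Lemma kernel_lift F F' G T (a : nattrans F G) (a' : nattrans F' G)
    (b : nattrans G T) :
  (forall Z (x : F Z), ntf a x = 0 -> x = 0) -> nt_exact a b -> nt_exact a' b ->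
  exists phi : nattrans F' F, forall Z (e : F' Z), ntf a (ntf phi e) = ntf a' e.
Proof.
move=> a0 exa exa'; have inj := nattrans_inj a0.
have tot Z (e : F' Z) : exists u, ntf a u = ntf a' e.
  have be : ntf b (ntf a' e) = 0 by apply/(exa' Z); exists e.
  by have [u ->] := (exa Z _).1 be; exists u.
pose phi Z (e : F' Z) := sval (cid (tot Z e)).
have phiP Z (e : F' Z) : ntf a (phi Z e) = ntf a' e.
  exact: (svalP (cid (tot Z e))).
unshelve eexists (@Nattrans _ F' F phi _ _); last by move=> Z e; apply: phiP.
- by move=> Z x y; apply: inj; rewrite ntD !phiP ntD.
by move=> Z Z' g x; apply: inj; rewrite nt_nat !phiP nt_nat.
Qed.

Lemma kernel_iso F F' G T (a : nattrans F G) (a' : nattrans F' G)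
    (b : nattrans G T) : short_exact a b -> short_exact a' b ->
  exists phi : nattrans F' F,
    nt_iso phi /\ forall Z (e : F' Z), ntf a (ntf phi e) = ntf a' e.
Proof.
move=> [a0 exa _] [a0' exa' _].
have [phi phiP] := kernel_lift a0 exa exa'.
have [psi psiP] := kernel_lift a0' exa' exa.
exists phi; split=> //; exists psi; split=> Z x.
  by apply: (nattrans_inj a0'); rewrite psiP phiP.
by apply: (nattrans_inj a0); rewrite phiP psiP.
Qed.

End Functors.

(** * Triangles in an extriangulated category *)

Section Extriangulated.
Variable C : extriangulated.
Implicit Types A B D W Z S : C.
Local Notation E := (EE C).

Lemma pullr0 (F : bifunctor C) (Z W A : C) (f : mor Z W) :
  pull F f (0 : F W A) = 0.
Proof. by apply: (addrI (pull F f 0)); rewrite -pullDr !addr0. Qed.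

Lemma real_id0 A Z : zero_object Z -> real (0 : E Z A) (idm A) (0 : mor A Z).
Proof. by move=> Z0; apply: real_0 (biprod_zero A Z0). Qed.

Lemma real_0id A Z : zero_object Z -> real (0 : E A Z) (0 : mor Z A) (idm A).
Proof. by move=> Z0; apply: real_0 (biprodC (biprod_zero A Z0)). Qed.

Section Triangle.
Variables (A B D : C) (d : E D A) (x : mor A B) (y : mor B D).
Hypothesis dxy : real d x y.

Lemma real_comp0 : y ∘ x = 0.
Proof.
have [[Z Z0] _] := excat_additive C.
have [|c [<- _]] := ET3 (a := idm A) (b := x) (real_id0 A Z0) dxy => //.
by rewrite mcompm0.
Qed.

Lemma real_pull0 : pull E y d = 0.
Proof.
have [[Z Z0] _] := excat_additive C.
have [|a [_ <-]] := ET3op (b := idm B) (c := y) (real_0id B Z0) dxy => //.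
exact: pushr0.
Qed.

Lemma real_push0 : push E x d = 0.
Proof.
have [[Z Z0] _] := excat_additive C.
have [|c [_ ->]] := ET3 (a := x) (b := idm B) dxy (real_id0 B Z0) => //.
exact: pullr0.
Qed.

Lemma real_colift W (g : mor B W) : g ∘ x = 0 -> exists h, h ∘ y = g.
Proof.
move=> gx; have [[Z Z0] _] := excat_additive C.
have [|h [e _]] := ET3 (a := 0) (b := g) dxy (real_0id W Z0).
  by rewrite mcompm0 gx.
by exists h; rewrite e mcomp1m.
Qed.

Lemma real_lift_pull W (g : mor W D) : pull E g d = 0 -> exists h, y ∘ h = g.
Proof.
move=> gd; have [[Z Z0] _] := excat_additive C.
have [|h [_ e]] := real_mor (a := 0 : mor Z A) (c := g) (real_0id W Z0) dxy.
  by rewrite gd pushr0.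
by exists h; rewrite e mcompm1.
Qed.

Lemma real_colift_push W (g : mor A W) : push E g d = 0 -> exists h, h ∘ x = g.
Proof.
move=> gd; have [[Z Z0] _] := excat_additive C.
have [|h [e _]] := real_mor (a := g) (c := 0 : mor D Z) dxy (real_id0 W Z0).
  by rewrite gd pullr0.
by exists h; rewrite e mcomp1m.
Qed.

End Triangle.

(** Exactness at E(W, A), then at E(D, W), in the long exact sequences of a
    triangle: realize e and compare its triangle with the given one. *)
Lemma real_pull_of A B D (d : E D A) (x : mor A B) (y : mor B D) W (e : E W A) :
  real d x y -> push E x e = 0 -> exists g, e = pull E g d.
Proof.
move=> dxy xe; have [Z [x' [y' exy]]] := real_ex e.
have [h hx'] := real_colift_push exy xe.
have [|c [_ ec]] := ET3 (a := idm A) (b := h) exy dxy; first by rewrite mcompm1.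
by exists c; rewrite -ec push1.
Qed.

Lemma real_push_of A B D (d : E D A) (x : mor A B) (y : mor B D) W (e : E D W) :
  real d x y -> pull E y e = 0 -> exists g, e = push E g d.
Proof.
move=> dxy ye; have [Z [x' [y' exy]]] := real_ex e.
have [h yh] := real_lift_pull exy ye.
have [|a [_ ea]] := ET3op (b := h) (c := idm D) dxy exy; first by rewrite mcomp1m.
by exists a; rewrite ea pull1.
Qed.

(** The first term of a triangle is determined by its deflation: by the five
    lemma, precomposition with the comparison morphism a : A -> A' is bijective
    on morphisms out of A' and A. *)
Lemma real_kernel_iso A A' B D (d : E D A) (d' : E D A') (x : mor A B)
    (x' : mor A' B) (y : mor B D) :
  real d x y -> real d' x' y ->
  exists (a : mor A A') (b : mor A' A), b ∘ a = idm A /\ a ∘ b = idm A'.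
Proof.
move=> t t'; have [|a [ea ead]] := ET3op (b := idm B) (c := idm D) t t'.
  by rewrite mcompm1 mcomp1m.
rewrite mcomp1m in ea; rewrite pull1 in ead.
(* g is a left inverse of a up to a morphism that factors through x. *)
have [g gd'] := real_push_of t' (real_pull0 t).
have [|h hx] := real_colift_push t (g := g ∘ a - idm A).
  by rewrite pushDl pushN push1 pushM ead -gd' subrr.
have ba : (g - h ∘ x') ∘ a = idm A.
  by rewrite !mcompE -(mcompA h) -ea hx opprB addrC addrNK.
exists a, (g - h ∘ x'); split=> //; move: (g - _) ba => b ba.
(* a ∘ b - 1 is killed by a on the right, hence vanishes. *)
have [|v vx'] := real_colift_push t' (g := a ∘ b - idm A').
  by rewrite -ead -pushM !mcompE -mcompA ba mcompm1 subrr push0.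
have [|w wy] := real_colift t (g := v).
  by rewrite ea mcompA vx' !mcompE -mcompA ba mcompm1 subrr.
apply/eqP; rewrite -subr_eq0 -vx' -wy -mcompA (real_comp0 t').
by rewrite mcompm0.
Qed.

Lemma real_comp_iso A B B' D (d : E D A) (x : mor A B) (y : mor B D)
    (f : mor B B') (g : mor B' B) :
  g ∘ f = idm B -> f ∘ g = idm B' -> real d x y -> real d (f ∘ x) (y ∘ g).
Proof.
move=> gf fg t; apply/(real_class _ _ t); exists f; split=> //; first by exists g.
by rewrite -mcompA gf mcompm1.
Qed.

(** If r is a retraction of x, then d = r_* (x_* d) = 0. *)
Lemma real_retraction A B D (d : E D A) (x : mor A B) (y : mor B D) r :
  real d x y -> r ∘ x = idm A -> d = 0 /\ exists s, biprod x s r y.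
Proof.
move=> t rx.
have d0 : d = 0 by rewrite -(push1 d) -rx pushM (real_push0 t) pushr0.
split=> //; have [|s ys] := real_lift_pull t (g := idm D); first by rewrite d0 pullr0.
have [|v vy] := real_colift t (g := idm B - x ∘ r).
  by rewrite !mcompE -mcompA rx mcompm1 subrr.
have y_epi W (f g : mor D W) : f ∘ y = g ∘ y -> f = g.
  by move=> /(congr1 (fun h => h ∘ s)); rewrite -!mcompA ys !mcompm1.
exists v; split=> //.
- by apply: y_epi; rewrite -mcompA vy !mcompE (real_comp0 t) !mcompE.
- by apply: y_epi; rewrite -mcompA vy !mcompE rx mcomp1m subrr.
- exact: real_comp0 t.
by rewrite vy addrC addrNK.
Qed.

Lemma infl_comp A B D (x : mor A B) (x' : mor B D) :
  inflation (econf C) x -> inflation (econf C) x' -> inflation (econf C) (x' ∘ x).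
Proof.
move=> [D1 [y [d t]]] [D2 [y' [d' t']]].
by have [G [h [u [v [d'' [[_ _ ?] _]]]]]] := ET4 t t'; exists G, h, d''.
Qed.

Lemma infl_sum A B A' B' (x : mor A B) (x' : mor A' B')
    SA (iA : mor A SA) (iA' : mor A' SA) pA pA'
    SB (iB : mor B SB) (iB' : mor B' SB) pB pB' :
  biprod iA iA' pA pA' -> biprod iB iB' pB pB' ->
  inflation (econf C) x -> inflation (econf C) x' ->
  inflation (econf C) (iB ∘ x ∘ pA + iB' ∘ x' ∘ pA').
Proof.
move=> bA bB [D [y [d t]]] [D' [y' [d' t']]].
have [SD [iD [iD' [pD [pD' bD]]]]] := (excat_additive C).2 D D'.
by do 2!eexists; eexists; apply: (real_D bA bB bD t t').
Qed.

Lemma infl_id A : inflation (econf C) (idm A).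
Proof.
have [[Z Z0] _] := excat_additive C.
by exists Z, 0, 0; apply: real_id0.
Qed.

(** The lower triangular matrix with diagonal x, x' is the composite of three
    inflations: 1 ⊕ x' : A ⊕ A' -> A ⊕ B', a unipotent automorphism of A ⊕ B',
    and x ⊕ 1. *)
Lemma infl_triangular A B A' B' (x : mor A B) (x' : mor A' B') (phi : mor A B')
    SA (iA : mor A SA) (iA' : mor A' SA) pA pA'
    SB (iB : mor B SB) (iB' : mor B' SB) pB pB' :
  biprod iA iA' pA pA' -> biprod iB iB' pB pB' ->
  inflation (econf C) x -> inflation (econf C) x' ->
  inflation (econf C) (iB ∘ x ∘ pA + iB' ∘ phi ∘ pA + iB' ∘ x' ∘ pA').
Proof.
move=> bA bB ix ix'.
have [T [j [j' [q [q' bT]]]]] := (excat_additive C).2 A B'.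
have bE := (biprodE bA, biprodE bB, biprodE bT).
pose u := idm T + j' ∘ phi ∘ q.
pose u' := idm T - j' ∘ phi ∘ q.
have iu : inflation (econf C) u.
  have [D [y [d t]]] := infl_id T; exists D, (y ∘ u'), d.
  by rewrite -[u]mcompm1; apply: real_comp_iso t;
    rewrite /u /u' !(mcompE, bE) ?addrNK ?addrK // ?subrr.
have := infl_comp (infl_comp (infl_sum bA bT (infl_id A) ix') iu)
  (infl_sum bT bB ix (infl_id B')).
set f := _ ∘ _; set g := _ + _ => F; suff -> : g = f by [].
rewrite /f /g /u.
by apply: (biprod_eq_in bA); apply: (biprod_eq_out bB); rewrite !(mcompE, bE).
Qed.

(** Schanuel's lemma: both sides are the kernel of (q, q') : P ⊕ P' -> A. *)
Lemma schanuel A K P K' P' (d : E A K) (d' : E A K') (k : mor K P)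
    (k' : mor K' P') (q : mor P A) (q' : mor P' A) (s : mor P P') (t : mor P' P)
    S (iS : mor K S) (jS : mor P' S) pS qS T (iT : mor K' T) (jT : mor P T) pT qT :
  real d k q -> real d' k' q' -> q' ∘ s = q -> q ∘ t = q' ->
  biprod iS jS pS qS -> biprod iT jT pT qT ->
  exists (a : mor S T) (b : mor T S), b ∘ a = idm S /\ a ∘ b = idm T.
Proof.
move=> r r' qs qt bS bT; have [[Z Z0] bps] := excat_additive C.
have [V [i [i' [p [p' bV]]]]] := bps P P'.
have bE := (biprodE bV, biprodE bS, biprodE bT).
have bA := biprod_zero A Z0.
have R1 := real_D bS bV bA r (real_id0 P' Z0).
have R2 := real_D bT (biprodC bV) bA r' (real_id0 P Z0).
rewrite !mcompE in R1 R2.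
have {}R1 := @real_comp_iso _ _ _ _ _ _ _ (idm V - i ∘ t ∘ p') (idm V + i ∘ t ∘ p') _ _ R1.
have {}R2 := @real_comp_iso _ _ _ _ _ _ _ (idm V - i' ∘ s ∘ p) (idm V + i' ∘ s ∘ p) _ _ R2.
rewrite !(mcompE, bE) qs qt !addrK !addrNK in R1 R2; rewrite (addrC (q' ∘ p')) in R2.
exact: real_kernel_iso (R1 erefl erefl) (R2 erefl erefl).
Qed.

End Extriangulated.

(** * Objects with a finite resolution *)

Section AddClosed.
Variables (C : preadd) (X : C -> Prop).
Hypothesis addC : additive_cat C.
Hypothesis X_add : forall A, X A <-> addc X A.

Lemma direct_summand_refl (A : C) : direct_summand A A.
Proof.
have [[Z Z0] _] := addC.
by exists Z, (idm A), 0, (idm A), 0; apply: biprod_zero.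
Qed.

Lemma addc_zero (Z : C) : zero_object Z -> X Z.
Proof.
move=> Z0; apply/X_add; exists 0%N.
exists (fun=> Z), Z; split; [by case | | exact: direct_summand_refl].
exists (fun=> 0), (fun=> 0); split; [by case | by case |].
by rewrite big_ord0 [RHS](Z0 Z).1.
Qed.

Lemma addc_summand (A A' S : C) (i1 : mor A S) (i2 : mor A' S) p1 p2 :
  biprod i1 i2 p1 p2 -> X S -> X A.
Proof.
move=> bp XS; apply/X_add; exists 1%N, (fun=> S), S; split=> //.
  exists (fun=> idm S), (fun=> idm S).
  split=> [j|j l|]; rewrite ?big_ord1 ?mcompm1 //.
  by rewrite (ord1 j) (ord1 l).
by exists A', i1, i2, p1, p2.
Qed.

Lemma addc_biprod (A A' S : C) (i1 : mor A S) (i2 : mor A' S) p1 p2 :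
  biprod i1 i2 p1 p2 -> X A -> X A' -> X S.
Proof.
move=> bp XA XA'; apply/X_add.
pose F (j : 'I_2) := if val j is 0%N then A else A'.
exists 2%N, F, S; split; last exact: direct_summand_refl.
  by case=> [[|]].
pose i_ (j : 'I_2) : mor (F j) S :=
  match val j as k return mor (if k is 0%N then A else A') S with
  | 0%N => i1 | _ => i2 end.
pose p_ (j : 'I_2) : mor S (F j) :=
  match val j as k return mor S (if k is 0%N then A else A') with
  | 0%N => p1 | _ => p2 end.
exists i_, p_; split; last by rewrite big_ord_recl big_ord1; apply: biprod_sum bp.
- case=> [[|[|//]] lt_j]; rewrite /F /i_ /p_ /=;
    [exact: biprod_p1i1 bp | exact: biprod_p2i2 bp].
case=> [[|[|//]] lt_j] [[|[|//]] lt_l] // ne; rewrite /F /i_ /p_ /=.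
- by case: ne; apply: val_inj.
- exact: biprod_p2i1 bp.
- exact: biprod_p1i2 bp.
by case: ne; apply: val_inj.
Qed.

Lemma addc_iso (A B : C) : isomorphic A B -> X B -> X A.
Proof.
have [[Z Z0] _] := addC => -[f [g [gf fg]]].
exact: addc_summand (biprod_iso gf fg (biprod_zero A Z0)).
Qed.

End AddClosed.

Section Resolutions.
Variables (C : extriangulated) (X : C -> Prop).
Hypothesis X_add : forall A, X A <-> addc X A.
Local Notation E := (EE C).
Let addC := excat_additive C.

(** The recursive form of [wedge], for inductions on the length. *)
Fixpoint resdim_le (m : nat) (A : C) : Prop :=
  if m is m'.+1 then
    exists K Y (x : mor K Y) (y : mor Y A),
      [/\ econf C _ _ _ x y, X Y & resdim_le m' K]
  else X A.

Lemma resdim_le0 m A : X A -> resdim_le m A.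
Proof.
have [[Z Z0] _] := addC.
elim: m A => [|m IH] A XA //=; exists Z, A, 0, (idm A); split=> //.
  by exists 0; apply: real_0id.
exact/IH/(addc_zero addC X_add).
Qed.

Lemma resdim_leS m A : resdim_le m A -> resdim_le m.+1 A.
Proof.
elim: m A => [|m IH] A; first exact: (@resdim_le0 1).
by move=> [K [Y [x [y [c XY /IH hK]]]]]; exists K, Y, x, y.
Qed.

Lemma resdim_le_trans m p A : (m <= p)%N -> resdim_le m A -> resdim_le p A.
Proof.
move=> /subnKC <-; elim: (p - m)%N => [|k IH]; rewrite ?addn0 // addnS => hA.
exact/resdim_leS/IH.
Qed.

Lemma resdim_leP m A : wedge (econf C) X m A <-> resdim_le m A.
Proof.
split=> [[p [le_pm]]|hA].
  move=> hA; apply: resdim_le_trans le_pm _.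
  elim: p A hA => [|p IH] A [K [Y [<- XY hK isoK]]].
    exact: (addc_iso addC X_add isoK (XY 0%N isT)).
  have [x [y c]] := hK 0%N isT.
  exists (K 1%N), (Y 0%N), x, y; split=> //; first exact: XY.
  apply: IH; exists (fun j => K j.+1), (fun j => Y j.+1).
  split=> [//|j lt_j|j lt_j|//]; [exact: XY | exact: hK].
exists m; split=> //; elim: m A hA => [|m IH] A.
  move=> XA; exists (fun=> A), (fun=> A); split=> //.
  by exists (idm A); apply: is_iso_id.
move=> [K1 [Y0 [x [y [c XY0 /IH [K [Y [e XY hK isoK]]]]]]]].
exists (fun j => if j is j'.+1 then K j' else A),
  (fun j => if j is j'.+1 then Y j' else Y0).
split=> //; first by case.
by case=> [|i] lt_i; [rewrite e; exists x, y | apply: hK].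
Qed.

Lemma resdim_le_biprod m A A' S (i1 : mor A S) (i2 : mor A' S) p1 p2 :
  biprod i1 i2 p1 p2 -> resdim_le m A -> resdim_le m A' -> resdim_le m S.
Proof.
elim: m A A' S i1 i2 p1 p2 => [|m IH] A A' S i1 i2 p1 p2 bp.
  exact: (addc_biprod addC X_add bp).
move=> [K [Y [x [y [[d t] XY hK]]]]] [K' [Y' [x' [y' [[d' t'] XY' hK']]]]].
have [SK [j1 [j2 [q1 [q2 bK]]]]] := addC.2 K K'.
have [SY [l1 [l2 [r1 [r2 bY]]]]] := addC.2 Y Y'.
exists SK, SY; eexists; eexists; split; last exact: IH bK hK hK'.
  by eexists; apply: real_D bK bY bp t t'.
exact: (addc_biprod addC X_add bY XY XY').
Qed.

Variables (n : nat) (H : higher_extensions C).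
Hypothesis X_rigid : rigid H n.+2 X.

Lemma E_resdim0 m A Z (e : E A Z) :
  (m <= n)%N -> X A -> resdim_le m Z -> e = 0.
Proof.
move=> le_mn XA hZ; apply: (E_wedge X_rigid) => //.
exact/resdim_leP/(resdim_le_trans le_mn).
Qed.

(** If N ⊕ B = A and Y -> A is the start of a resolution with kernel K, the
    composites Y -> N and Y -> B are deflations, say with kernels G and G'.
    By Schanuel's lemma G ⊕ G' ⊕ Y is isomorphic to K ⊕ (Y ⊕ Y), so G is a
    summand of an object with a shorter resolution. *)
Lemma resdim_le_summand m N B A (i1 : mor N A) (i2 : mor B A) p1 p2 :
  (m <= n.+1)%N -> biprod i1 i2 p1 p2 -> resdim_le m A -> resdim_le m N.
Proof.
elim: m N B A i1 i2 p1 p2 => [|m IH] N B A i1 i2 p1 p2 le_mn bp.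
  exact: (addc_summand X_add bp).
move=> [K [Y [k [q [[d t] XY hK]]]]].
have kernel U V (i : mor U A) (j : mor V A) p r : biprod i j p r ->
    exists G (g : mor G Y) e, real e g (p ∘ q).
  move=> b; have [G [h' [_ [_ [e [[_ _ ?] _]]]]]] := ET4op t (real_0 (biprodC b)).
  by exists G, h', e.
have [G [g [e tG]]] := kernel _ _ _ _ _ _ bp.
have [G' [g' [e' tG']]] := kernel _ _ _ _ _ _ (biprodC bp).
have [GG [a1 [a2 [b1 [b2 bG]]]]] := addC.2 G G'.
have [YY [c1 [c2 [d1 [d2 bY]]]]] := addC.2 Y Y.
have tS := real_D bG bY bp tG tG'.
have XYY : X YY by apply: (addc_biprod addC X_add bY).
have bE := (biprodE bp, biprodE bY).
set y := i1 ∘ _ ∘ _ + _ in tS.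
have [|s qs] := real_lift_pull t (g := y).
  by apply: E_resdim0 hK.
have [S [u1 [u2 [v1 [v2 bS]]]]] := addC.2 K YY.
have [T [w1 [w2 [z1 [z2 bT]]]]] := addC.2 GG Y.
have [|f [f' [f'f ff']]] := schanuel (s := c1 + c2) t tS _ qs bS bT.
  rewrite /y !(mcompE, bE) -mcompDl.
  by rewrite (biprod_sum bp) mcomp1m.
have hS : resdim_le m S by apply: resdim_le_biprod bS hK (resdim_le0 _ XYY).
have le_m : (m <= n.+1)%N by apply: ltnW.
have hGG := IH _ _ _ _ _ _ _ le_m (biprod_iso ff' f'f bT) hS.
exists G, Y, g, (p1 ∘ q); split=> //; first by exists e.
exact: IH le_m bG hGG.
Qed.

End Resolutions.

(** * Extension functors of the objects of M2 *)

Section ExactStructure.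
Variables (C : extriangulated) (X : C -> Prop) (n : nat) (H : higher_extensions C).
Hypothesis X_add : forall A, X A <-> addc X A.
Hypothesis X_rigid : rigid H n.+2 X.
Local Notation E := (EE C).
Local Notation M2 := (M2 X n).
Local Notation Xn := (Xbar X n).
Local Notation EM M Z := (EE C (sval M) (sval Z)).
Let addC := excat_additive C.
Implicit Types (M N T A B D : M2) (Z : Xn).

Lemma cls_surj M N (h : mor M N) : exists f : @mor C (sval M) (sval N), h = cls f.
Proof. by exists (qrepr h); rewrite /cls qreprK. Qed.

Lemma clsM M N T (g : @mor C (sval N) (sval T)) (f : @mor C (sval M) (sval N)) :
  cls (g ∘ f) = cls g ∘ cls f :> mor M T.
Proof. exact: (esym (qcompE _ _ _)). Qed.

Lemma clsD M N (f g : @mor C (sval M) (sval N)) :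
  cls (f + g) = cls f + cls g :> mor M N.
Proof. exact: (@qclsD (Xn1 X n)). Qed.

Lemma cls_factor M N (Y : C) (g : mor Y (sval N)) (f : mor (sval M) Y) :
  X Y -> cls (g ∘ f) = 0 :> mor M N.
Proof.
move=> XY; have wY : wedge (econf C) X n.+1 Y.
  exact/(resdim_leP X_add)/resdim_le0.
apply/(@qcls_eq0 (Xn1 X n)).
by exists 1%N, (fun=> exist _ Y wY), (fun=> g), (fun=> f); rewrite big_ord1.
Qed.

(** [Kmor] on elements, which are seen in the extension groups of C rather than
    as values of a functor on the quotient category, so that [push] along
    morphisms of C applies to them. *)
Definition kap M N (h : mor M N) Z (e : EM N Z) : EM M Z := ntf (Kmor h) e.

Lemma kap_cls M N (f : @mor C (sval M) (sval N)) Z (e : EM N Z) :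
  kap (cls f : mor M N) e = pull E f e.
Proof. exact: (Kmor_cls X_rigid f e). Qed.

Lemma kap_push M N (h : mor M N) Z Z' (g : @mor C (sval Z) (sval Z')) (e : EM N Z) :
  push E g (kap h e) = kap h (push E g e).
Proof. exact: push_pull. Qed.

Lemma kapDr M N (h : mor M N) Z (e e' : EM N Z) : kap h (e + e') = kap h e + kap h e'.
Proof. exact: pullDr. Qed.

Lemma kapr0 M N (h : mor M N) Z : kap h (0 : EM N Z) = 0.
Proof. exact: pullr0. Qed.

Lemma kapBr M N (h : mor M N) Z (e e' : EM N Z) : kap h (e - e') = kap h e - kap h e'.
Proof. by apply/eqP; rewrite eq_sym subr_eq -kapDr subrK. Qed.

Lemma kapM M N T (g : mor N T) (f : mor M N) Z (e : EM T Z) :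
  kap (g ∘ f) e = kap f (kap g e).
Proof.
have [[g' ->] [f' ->]] := (cls_surj g, cls_surj f).
by rewrite -clsM !kap_cls pullM.
Qed.

Lemma kap1 M Z (e : EM M Z) : kap (idm M) e = e.
Proof. by rewrite [LHS](kap_cls (idm (sval M))) pull1. Qed.

Lemma kapDl M N (h h' : mor M N) Z (e : EM N Z) : kap (h + h') e = kap h e + kap h' e.
Proof.
have [[g' ->] [f' ->]] := (cls_surj h, cls_surj h').
by rewrite -clsD !kap_cls pullDl.
Qed.

Lemma kap0 M N Z (e : EM N Z) : kap (0 : mor M N) e = 0.
Proof. by apply: (addrI (kap 0 e)); rewrite -kapDl !addr0. Qed.

Lemma kapN M N (h : mor M N) Z (e : EM N Z) : kap (- h) e = - kap h e.
Proof. by apply: (addrI (kap h e)); rewrite -kapDl !subrr kap0. Qed.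

(** The first triangle of a resolution of M presents the functor of M by the
    generator pd and the relation px_* pd = 0; see [pres_gen], [pres_rel]. *)
Record presentation M := Presentation {
  pK : Xn;
  pY : Xn;
  px : @mor C (sval pK) (sval pY);
  py : @mor C (sval pY) (sval M);
  pd : EM M pK;
  pY_X : X (sval pY);
  p_real : real pd px py }.

Lemma presentation_ex M : inhabited (presentation M).
Proof.
have /(resdim_leP X_add) [K [Y [x [y [[d t] XY hK]]]]] := svalP M.
have wK : wedge (econf C) X n K by apply/resdim_leP.
have wY : wedge (econf C) X n Y by apply/resdim_leP => //; apply: resdim_le0.
by split; apply: (@Presentation M (exist _ K wK) (exist _ Y wY) x y d).
Qed.

Lemma E_X_Xn Z Z' (e : EM Z' Z) : X (sval Z') -> e = 0.
Proof.
move=> XZ'; have hZ := (resdim_leP X_add n (sval Z)).1 (svalP Z).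
exact: (E_resdim0 X_add X_rigid e (leqnn n) XZ' hZ).
Qed.

Lemma pres_gen M (p : presentation M) Z (e : EM M Z) :
  exists g : @mor C (sval (pK p)) (sval Z), e = push E g (pd p).
Proof. by apply: real_push_of (p_real p) _; apply: E_X_Xn; apply: pY_X. Qed.

Lemma pres_rel M (p : presentation M) Z (g : @mor C (sval (pK p)) (sval Z)) :
  push E g (pd p) = 0 -> exists h : @mor C (sval (pY p)) (sval Z), g = h ∘ px p.
Proof. by move=> /(real_colift_push (p_real p)) [h <-]; exists h. Qed.

Lemma pres_push0 M (p : presentation M) : push E (px p) (pd p) = 0.
Proof. exact: real_push0 (p_real p). Qed.

(** An element satisfying the relation of the generator pd is the image of pd
    under a morphism, by exactness at E(M, pK). *)
Lemma kap_full M N (p : presentation N) (c : EM M (pK p)) :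
  push E (px p) c = 0 -> exists h : mor M N, kap h (pd p) = c.
Proof.
move=> /(real_pull_of (p_real p)) [g ->].
by exists (cls g); rewrite kap_cls.
Qed.

(** A morphism of C that kills pd lifts to pY, so it is zero in M2. *)
Lemma kap_faithful_at M N (p : presentation N) (h h' : mor M N) :
  kap h (pd p) = kap h' (pd p) -> h = h'.
Proof.
move=> e; apply/eqP; rewrite -subr_eq0; apply/eqP.
have {e} : kap (h - h') (pd p) = 0 by rewrite kapDl kapN e subrr.
have [g ->] := cls_surj (h - h').
rewrite kap_cls => /(real_lift_pull (p_real p)) [u <-].
by apply: cls_factor; apply: pY_X.
Qed.

Lemma kap_faithful M N (h h' : mor M N) :
  (forall Z (e : EM N Z), kap h e = kap h' e) -> h = h'.
Proof. by have [p] := presentation_ex N => e; apply: (kap_faithful_at (p := p)). Qed.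

(** A natural transformation between the functors of N and M, given by its graph
    R, is induced by a morphism of M2: any value of R at the generator of N
    satisfies the relation of the generator. *)
Lemma mor_of_rel M N (R : forall Z, EM N Z -> EM M Z -> Prop) :
  (forall Z Z' (g : @mor C (sval Z) (sval Z')) e c,
     R Z e c -> R Z' (push E g e) (push E g c)) ->
  (forall Z e c e' c', R Z e c -> R Z e' c' -> R Z (e - e') (c - c')) ->
  (forall Z c, R Z 0 c -> c = 0) -> (forall Z e, exists c, R Z e c) ->
  exists h : mor M N, forall Z e c, R Z e c -> kap h e = c.
Proof.
move=> Rpush Rsub R0 Rtot; have [p] := presentation_ex N.
have [c0 Rc0] := Rtot _ (pd p).
have [|h hd] := @kap_full M N p c0.
  by apply: R0; rewrite -(pres_push0 p); apply: Rpush.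
exists h => Z e c Rec; have [g ge] := pres_gen p e.
apply/eqP; rewrite eq_sym -subr_eq0; apply/eqP/R0; rewrite -(subrr e).
by apply: Rsub => //; rewrite {1}ge ge -kap_push hd; apply: Rpush.
Qed.

Lemma eps_KP A B D (a : mor A B) (b : mor B D) :
  @eps_K C X n A B D a b <->
  [/\ forall Z (e : EM D Z), kap b e = 0 -> e = 0,
      forall Z (e : EM B Z), kap a e = 0 <-> exists u, e = kap b u
    & forall Z (e : EM A Z), exists u, e = kap a u].
Proof. by []. Qed.

Lemma eps_KI A B D (a : mor A B) (b : mor B D) : b ∘ a = 0 ->
  (forall Z (e : EM D Z), kap b e = 0 -> e = 0) ->
  (forall Z (e : EM B Z), kap a e = 0 -> exists u, e = kap b u) ->
  (forall Z (e : EM A Z), exists u, e = kap a u) -> @eps_K C X n A B D a b.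
Proof.
move=> ba inj ex sur; apply/eps_KP; split=> // Z e; split; first exact: ex.
by move=> [u ->]; rewrite -kapM ba kap0.
Qed.

(** * The exact structure of M2 *)

Section EpsK.
Variables (A B D : M2) (a : mor A B) (b : mor B D).
Hypothesis c : @eps_K C X n A B D a b.

Lemma eps_inj Z (e : EM D Z) : kap b e = 0 -> e = 0.
Proof. by case: c => inj _ _; apply: inj. Qed.
Lemma eps_exact Z (e : EM B Z) : kap a e = 0 -> exists u, e = kap b u.
Proof. by case: c => _ ex _ /ex. Qed.
Lemma eps_surj Z (e : EM A Z) : exists u, e = kap a u.
Proof. by case: c => _ _ sur; apply: sur. Qed.
Lemma eps_zero Z (e : EM D Z) : kap a (kap b e) = 0.
Proof. by case: c => _ ex _; apply/ex; exists e. Qed.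
Lemma eps_comp0 : b ∘ a = 0.
Proof. by apply: kap_faithful => Z e; rewrite kapM kap0; apply: eps_zero. Qed.

Lemma eps_mono : is_mono a.
Proof.
move=> T g h e; apply: kap_faithful => Z z; have [u ->] := eps_surj z.
by rewrite -!kapM e.
Qed.

Lemma eps_epi : is_epi b.
Proof.
move=> T g h e; apply: kap_faithful => Z z.
apply/eqP; rewrite -subr_eq0; apply/eqP/eps_inj.
by rewrite kapBr -!kapM e subrr.
Qed.

Lemma eps_is_kernel : is_kernel b a.
Proof.
apply: is_kernelI; [exact: eps_comp0 | exact: eps_mono |] => T g bg.
have [||||h hP] := @mor_of_rel T A (fun Z e z => exists u, e = kap a u /\ z = kap g u).
- by move=> Z Z' w e z [u [-> ->]]; exists (push E w u); rewrite !kap_push.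
- move=> Z e z e' z' [u [-> ->]] [u' [-> ->]].
  by exists (u - u'); rewrite !kapBr.
- move=> Z z [u [/esym/eps_exact [v ->] ->]].
  by rewrite -kapM bg kap0.
- by move=> Z e; have [u ->] := eps_surj e; exists (kap g u), u.
exists h; apply: kap_faithful => Z e; rewrite kapM; apply: hP.
by exists e.
Qed.

Lemma eps_is_cokernel : is_cokernel a b.
Proof.
apply: is_cokernelI; [exact: eps_comp0 | exact: eps_epi |] => T g ga.
have [||||h hP] := @mor_of_rel D T (fun Z e z => kap b z = kap g e).
- by move=> Z Z' w e z bz; rewrite -!kap_push bz.
- by move=> Z e z e' z' bz bz'; rewrite !kapBr bz bz'.
- by move=> Z z; rewrite kapr0 => /eps_inj.
- move=> Z e; have [|u ->] := @eps_exact Z (kap g e); last by exists u.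
  by rewrite -kapM ga kap0.
apply: (ex_intro _ h); apply: kap_faithful => Z e; rewrite kapM.
have [|u ge] := @eps_exact Z (kap g e); first by rewrite -kapM ga kap0.
by rewrite ge; congr (kap b _); apply: hP.
Qed.

(** The functor of B is generated by that of D and a lift c0 of the generator
    of A, subject to the relation px_* c0 = b^* psi. *)
Section Generators.
Variables (p : presentation A) (c0 : EM B (pK p)) (psi : EM D (pY p)).
Hypotheses (ac0 : kap a c0 = pd p) (xc0 : push E (px p) c0 = kap b psi).

Lemma eps_gen Z (e : EM B Z) : exists d g, e = kap b d + push E g c0.
Proof.
have [g eg] := pres_gen p (kap a e).
have [|d ed] := @eps_exact _ (e - push E g c0).
  by rewrite kapBr -kap_push ac0 eg subrr.
by exists d, g; rewrite -ed subrK.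
Qed.

Lemma eps_gen_rel Z (d : EM D Z) (g : @mor C (sval (pK p)) (sval Z)) :
  kap b d + push E g c0 = 0 ->
  exists h : @mor C (sval (pY p)) (sval Z), g = h ∘ px p /\ d = - push E h psi.
Proof.
move=> e; have [|h eg] := @pres_rel _ p _ g.
  by have := congr1 (@kap _ _ a Z) e; rewrite kapDr -kap_push ac0 eps_zero add0r kapr0.
exists h; split=> //; apply/eqP; rewrite -addr_eq0; apply/eqP/eps_inj.
by rewrite kapDr -kap_push -xc0 -pushM -eg.
Qed.

Lemma eps_rel0 Z (h : @mor C (sval (pY p)) (sval Z)) :
  h ∘ px p = 0 -> push E h psi = 0.
Proof.
by move=> hx; apply: eps_inj; rewrite -kap_push -xc0 -pushM hx push0.
Qed.

(** The functor of B is presented by that of D, the generator c0 and the relation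
    between c0 and psi, so a morphism into B is a morphism t into D together
    with an image tau of c0 that satisfies this relation. *)
Lemma eps_map_into T (t : mor T D) (tau : EM T (pK p)) :
  push E (px p) tau = kap t psi -> exists w : mor T B, b ∘ w = t /\ kap w c0 = tau.
Proof.
move=> xtau.
pose R Z e z := exists d (g : @mor C (sval (pK p)) (sval Z)),
  e = kap b d + push E g c0 /\ z = kap t d + push E g tau.
have [||||w wP] := @mor_of_rel T B R.
- move=> Z Z' u e z [d [g [-> ->]]]; exists (push E u d), (u ∘ g).
  by rewrite !pushDr !kap_push !pushM.
- move=> Z e z e' z' [d [g [-> ->]]] [d' [g' [-> ->]]].
  exists (d - d'), (g - g'); rewrite !kapBr !pushDl !pushN.
  by split; rewrite opprD addrACA.
- move=> Z z [d [g [/esym/eps_gen_rel [h [-> ->]] ->]]].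
  by rewrite pushM xtau kap_push -[- _]sub0r kapBr kapr0 sub0r addNr.
- by move=> Z e; have [d [g ->]] := eps_gen e; exists (kap t d + push E g tau), d, g.
exists w; split.
  apply: kap_faithful => Z e; rewrite kapM; apply: wP.
  by exists e, 0; rewrite !push0 !addr0.
by apply: wP; exists 0, (idm _); rewrite !kapr0 !push1 !add0r.
Qed.

End Generators.

Lemma eps_lift (p : presentation A) : exists (c0 : EM B (pK p)) (psi : EM D (pY p)),
  kap a c0 = pd p /\ push E (px p) c0 = kap b psi.
Proof.
have [c0 ac0] := eps_surj (pd p); exists c0.
have [|psi e] := @eps_exact _ (push E (px p) c0); last by exists psi.
by rewrite -kap_push -ac0 pres_push0.
Qed.

End EpsK.

(** Every psi subject to the relations that hold between the generators of A
    comes from a conflation A -> B -> D: if psi = phi_* (pd q), take for B the cone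
    of the lower triangular matrix with px q, px p on the diagonal and - phi
    below it.  The hypothesis holds for every conflation, by [eps_rel0]. *)
Lemma eps_extension A D (p : presentation A) (psi : EM D (pY p)) :
  (forall Z (h : @mor C (sval (pY p)) (sval Z)), h ∘ px p = 0 -> push E h psi = 0) ->
  exists (B : M2) (a : mor A B) (b : mor B D) (c0 : EM B (pK p)),
    [/\ @eps_K C X n A B D a b, kap a c0 = pd p & push E (px p) c0 = kap b psi].
Proof.
move=> psi0; have [q] := presentation_ex D; have [phi ephi] := pres_gen q psi.
have [K [iD [iA [pD [pA bK]]]]] := addC.2 (sval (pK q)) (sval (pK p)).
have [Y [jD [jA [rD [rA bY]]]]] := addC.2 (sval (pY q)) (sval (pY p)).
have hK : resdim_le X n K.
  by apply: (resdim_le_biprod X_add bK); apply/(resdim_leP X_add)/svalP.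
have XY : X Y by apply: (addc_biprod addC X_add bY); apply: pY_X.
have hY : resdim_le X n Y by apply: resdim_le0.
have ix : inflation (econf C) (px q) by exists (sval D), (py q), (pd q); apply: p_real.
have ix' : inflation (econf C) (px p) by exists (sval A), (py p), (pd p); apply: p_real.
have [B0 [y [d t]]] := infl_triangular (- phi) bK bY ix ix'.
set x := _ + _ in t.
have wB : wedge (econf C) X n.+1 B0.
  by apply/(resdim_leP X_add); exists K, Y, x, y; split=> //; exists d.
pose B : M2 := exist _ B0 wB.
pose KB : Xn := exist _ K ((resdim_leP X_add n K).2 hK).
pose YB : Xn := exist _ Y ((resdim_leP X_add n Y).2 hY).
pose pB := @Presentation B KB YB x y d XY t.
have bE := (biprodE bK, biprodE bY).
have xd0 : push E x d = 0 := real_push0 t.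
have [|a ad] := @kap_full A B pB (push E iA (pd p)).
  rewrite -pushM /= /x !(mcompE, bE) pushM pres_push0 pushr0 //.
have [|b bd] := @kap_full B D q (push E pD d).
  have -> : push E (px q) (push E pD d) = push E rD (push E x d).
    by rewrite -!pushM /x !(mcompE, bE).
  by rewrite xd0 pushr0.
pose c0 : EM B (pK p) := push E pA d.
have ac0 : kap a c0 = pd p.
  by rewrite /c0 -(@kap_push _ _ a KB (pK p)) ad -pushM (biprodE bK) push1.
have xc0 : push E (px p) c0 = kap b psi.
  rewrite ephi -kap_push bd /c0 -!pushM; apply/eqP; rewrite eq_sym -subr_eq0.
  rewrite -pushN -pushDl -oppr_eq0 -pushN opprB.
  have -> : px p ∘ pA - phi ∘ pD = rA ∘ x by rewrite /x !(mcompE, bE) addrC.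
  by rewrite pushM xd0 pushr0.
exists B, a, b, c0; split=> //; apply: eps_KI.
- apply: (kap_faithful_at (p := q)).
  rewrite kapM bd -(@kap_push _ _ a KB (pK q)) ad -pushM (biprodE bK) push0.
  by rewrite kap0.
- move=> Z e; have [g ->] := pres_gen q e; rewrite -kap_push bd -pushM.
  move=> /(@pres_rel _ pB) [h ehx].
  have eg : g = h ∘ jD ∘ px q - h ∘ jA ∘ phi.
    by have := congr1 (fun f => f ∘ iD) ehx; rewrite /= /x !(mcompE, bE).
  have hx : h ∘ jA ∘ px p = 0.
    by have := congr1 (fun f => f ∘ iA) ehx; rewrite /= /x !(mcompE, bE).
  rewrite eg pushDl pushN !pushM -pushM pushM pres_push0 !pushr0 -ephi -pushM.
  by rewrite psi0 // subr0.
- move=> Z e; have [g eg] := pres_gen pB e; rewrite eg -(@kap_push _ _ a KB) ad -pushM.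
  move=> /(@pres_rel _ p) [h ehx].
  exists (push E (g ∘ iD) (pd q) + push E h psi).
  rewrite kapDr -!kap_push -xc0 bd -!pushM -ehx -pushDl /=.
  by rewrite -!mcompA -mcompDr (biprod_sum bK) mcompm1.
move=> Z e; have [g ->] := pres_gen p e; exists (push E g c0).
by rewrite -kap_push ac0.
Qed.

End ExactStructure.

Section ExactAxioms.
Variables (C : extriangulated) (X : C -> Prop) (n : nat) (H : higher_extensions C).
Hypothesis X_add : forall A, X A <-> addc X A.
Hypothesis X_rigid : rigid H n.+2 X.
Local Notation E := (EE C).
Local Notation M2 := (M2 X n).
Local Notation Xn := (Xbar X n).
Local Notation EM M Z := (EE C (sval M) (sval Z)).
Local Notation eps := (@eps_K C X n).
Let addC := excat_additive C.
Implicit Types (M N T A B D : M2) (Z : Xn).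
Let kM := kapM X_rigid.

Lemma M2_additive : additive_cat M2.
Proof.
apply: quotcat_additive; apply: (fullsub_additive addC) => [Z Z0|A B S i1 i2 p1 p2 bp].
  exact/(resdim_leP X_add)/resdim_le0/(addc_zero addC X_add).
move=> /(resdim_leP X_add) hA /(resdim_leP X_add) hB.
exact/(resdim_leP X_add)/(resdim_le_biprod X_add bp).
Qed.

Lemma kap_zero_object (O : M2) Z (e : EM O Z) : zero_object O -> e = 0.
Proof.
by move=> O0; rewrite -(kap1 X_rigid e) ((O0 _).1 (idm O)) (kap0 X_rigid).
Qed.

Lemma eps_id0 A (O : M2) : zero_object O -> eps (idm A) (0 : mor A O).
Proof.
move=> O0; apply: (eps_KI X_rigid); first by rewrite mcomp0m.
- by move=> Z e _; exact: (kap_zero_object e O0).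
- by move=> Z e; rewrite (kap1 X_rigid) => ->; exists 0; rewrite kapr0.
by move=> Z e; exists e; rewrite (kap1 X_rigid).
Qed.

Lemma eps_0id A (O : M2) : zero_object O -> eps (0 : mor O A) (idm A).
Proof.
move=> O0; apply: (eps_KI X_rigid); first by rewrite mcompm0.
- by move=> Z e; rewrite (kap1 X_rigid).
- by move=> Z e _; exists e; rewrite (kap1 X_rigid).
by move=> Z e; exists 0; rewrite kapr0; exact: (kap_zero_object e O0).
Qed.

Lemma eps_isoclosed A B D A' B' D' (x : mor A B) (y : mor B D) (x' : mor A' B')
    (y' : mor B' D') (a : mor A A') (b : mor B B') (d : mor D D') :
  is_iso a -> is_iso b -> is_iso d -> b ∘ x = x' ∘ a -> d ∘ y = y' ∘ b ->
  eps x y -> eps x' y'.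
Proof.
move=> [a' [a'a aa']] [b' [b'b bb']] [d' [d'd dd']] ex ey c.
have sqx Z (e : EM B' Z) : kap x (kap b e) = kap a (kap x' e).
  by rewrite -!kM ex.
have sqy Z (e : EM D' Z) : kap y (kap d e) = kap b (kap y' e).
  by rewrite -!kM ey.
have K (U V : M2) (f : mor U V) g Z (e : EM V Z) : f ∘ g = idm V -> kap g (kap f e) = e.
  by move=> fg; rewrite -kM fg (kap1 X_rigid).
apply: (eps_KI X_rigid).
- have -> : x' = b ∘ x ∘ a' by rewrite ex -mcompA aa' mcompm1.
  by rewrite !mcompA -ey (mcomp_eql (eps_comp0 X_add X_rigid c)) mcompm0 mcomp0m.
- move=> Z e y'e; rewrite -(K _ _ _ _ _ e dd').
  by rewrite (eps_inj c (e := kap d e)) ?kapr0 // sqy y'e kapr0.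
- move=> Z e x'e; have [|u eu] := eps_exact c (e := kap b e).
    by rewrite sqx x'e kapr0.
  exists (kap d' u); rewrite -(K _ _ _ _ _ e bb') eu -{1}(K _ _ _ _ _ u d'd) sqy.
  by rewrite (K _ _ _ _ _ _ bb').
move=> Z e; have [u eu] := eps_surj c (kap a e).
exists (kap b' u); rewrite -(K _ _ _ _ _ e aa') eu -{1}(K _ _ _ _ _ u b'b) sqx.
by rewrite (K _ _ _ _ _ _ aa').
Qed.

(** With D, D' the cokernels of x, x', the kernel of K(T) -> K(B) -> K(A) is an
    extension of K(D) = ker K(x) by K(D') = ker K(x'); [eps_extension]
    represents it by an object Q, the cokernel of x' ∘ x. *)
Lemma eps_infl_comp A B T (x : mor A B) (x' : mor B T) :
  inflation eps x -> inflation eps x' -> inflation eps (x' ∘ x).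
Proof.
move=> [D [y c]] [D' [y' c']]; have [p] := presentation_ex X_add D.
have [b0 xb0] := eps_surj c' (kap y (pd p)).
have [|psi eb0] := eps_exact c' (e := push E (px p) b0).
  by rewrite -kap_push -xb0 kap_push pres_push0 kapr0.
have [|Q [d [q [c0 [cQ dc0 xc0]]]]] := eps_extension X_add X_rigid (p := p) (psi := psi).
  by move=> Z h hx; apply: (eps_inj c'); rewrite -kap_push -eb0 -pushM hx push0.
have [w [qw wc0]] := eps_map_into X_add X_rigid cQ dc0 xc0 eb0.
have wE Z d0 (g : @mor C _ (sval Z)) :
    kap w (kap q d0 + push E g c0) = kap y' d0 + push E g b0.
  by rewrite kapDr -kM qw -kap_push wc0.
have xE Z d0 (g : @mor C _ (sval Z)) :
    kap x' (kap y' d0 + push E g b0) = kap y (push E g (pd p)).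
  by rewrite kapDr (eps_zero c') add0r -kap_push -xb0 kap_push.
exists Q, w; apply: (eps_KI X_rigid).
- apply: (kap_faithful X_add X_rigid) => Z e.
  have [d0 [g ->]] := eps_gen X_add X_rigid cQ dc0 e.
  by rewrite !kM wE xE (eps_zero c) (kap0 X_rigid).
- move=> Z e; have [d0 [g ->]] := eps_gen X_add X_rigid cQ dc0 e.
  rewrite wE => e0; have := congr1 (@kap _ _ _ _ _ x' Z) e0.
  rewrite xE kapr0 => /(eps_inj c) /pres_rel [h eg]; move: e0.
  rewrite eg !pushM eb0 xc0 !kap_push -!kapDr => /(eps_inj c') ->.
  exact: kapr0.
- move=> Z e; rewrite kM => /(eps_exact c) [v ev].
  have [g eg] := pres_gen X_add X_rigid p v.
  have [|d0 ed0] := eps_exact c' (e := e - push E g b0).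
    by rewrite kapBr -kap_push -xb0 ev eg kap_push subrr.
  by exists (kap q d0 + push E g c0); rewrite wE -ed0 subrK.
move=> Z e; have [u ->] := eps_surj c e; have [v ->] := eps_surj c' u.
by exists v; rewrite kM.
Qed.

(** With A, A' the kernels of y, y', the cokernel of K(D) -> K(B) -> K(T) is an
    extension of K(A) by K(A'), represented by the kernel Q of y' ∘ y. *)
Lemma eps_defl_comp T B D (y : mor T B) (y' : mor B D) :
  deflation eps y -> deflation eps y' -> deflation eps (y' ∘ y).
Proof.
move=> [A [x c]] [A' [x' c']]; have [p] := presentation_ex X_add A.
have [b0 [psi [xb0 eb0]]] := eps_lift c p.
have [|Q [a [q [c0 [cQ ac0 xc0]]]]] :=
    eps_extension X_add X_rigid (p := p) (psi := kap x' psi).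
  by move=> Z h hx; rewrite kap_push (eps_rel0 c eb0 hx) kapr0.
have [|w [yw wb0]] := eps_map_into X_add X_rigid c xb0 eb0 (t := x' ∘ q) (tau := c0).
  by rewrite xc0 kM.
have wE Z d0 (g : @mor C _ (sval Z)) :
    kap w (kap y d0 + push E g b0) = kap q (kap x' d0) + push E g c0.
  by rewrite kapDr -!kM yw -kap_push wb0.
exists Q, w; apply: (eps_KI X_rigid).
- by rewrite -mcompA yw mcompA (eps_comp0 X_add X_rigid c') mcomp0m.
- by move=> Z e; rewrite kM => /(eps_inj c) /(eps_inj c').
- move=> Z e; have [d0 [g ->]] := eps_gen X_add X_rigid c xb0 e.
  rewrite wE => /(eps_gen_rel cQ ac0 xc0) [h [-> ed0]].
  have [|v ev] := eps_exact c' (e := d0 + push E h psi).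
    by rewrite kapDr ed0 kap_push addNr.
  by exists v; rewrite kM -ev kapDr -kap_push -eb0 pushM.
move=> Z e; have [d0 [g ->]] := eps_gen X_add X_rigid cQ ac0 e.
have [v ->] := eps_surj c' d0.
by exists (kap y v + push E g b0); rewrite wE.
Qed.

(** The functor of the pushout is the fiber product of K(B) and K(A') over K(A),
    an extension of K(A') by K(D) where D is the cokernel of x. *)
Lemma eps_pushout A B A' (x : mor A B) (f : mor A A') : inflation eps x ->
  exists B' (x' : mor A' B') (f' : mor B B'),
    is_pushout x f x' f' /\ inflation eps x'.
Proof.
move=> [D [y c]]; have [p] := presentation_ex X_add A'.
have [b0 xb0] := eps_surj c (kap f (pd p)).
have [|psi eb0] := eps_exact c (e := push E (px p) b0).
  by rewrite -kap_push -xb0 kap_push pres_push0 kapr0.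
have [|B' [a [b [c0 [c' ac0 xc0]]]]] := eps_extension X_add X_rigid (p := p) (psi := psi).
  by move=> Z h hx; apply: (eps_inj c); rewrite -kap_push -eb0 -pushM hx push0.
have [f' [bf' fc0]] := eps_map_into X_add X_rigid c' ac0 xc0 eb0.
have f'b Z (d0 : EM D Z) : kap f' (kap b d0) = kap y d0 by rewrite -kM bf'.
exists B', a, f'; split; last by exists D, b.
have sq : a ∘ f = f' ∘ x.
  apply: (kap_faithful X_add X_rigid) => Z e.
  have [d0 [g ->]] := eps_gen X_add X_rigid c' ac0 e.
  rewrite !kM !kapDr -!kap_push f'b ac0 fc0 (eps_zero c') (eps_zero c).
  by rewrite kapr0 xb0.
split=> // T u v uf.
have mono Z (e : EM B' Z) : kap a e = 0 -> kap f' e = 0 -> e = 0.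
  move=> /(eps_exact c') [d0 ->]; rewrite f'b => /(eps_inj c) ->.
  exact: kapr0.
have tot Z (z : EM T Z) : exists e, kap a e = kap u z /\ kap f' e = kap v z.
  have [e1 ue1] := eps_surj c' (kap u z).
  have [|d0 ed0] := eps_exact c (e := kap v z - kap f' e1).
    by rewrite kapBr -!kM -uf -sq !kM ue1 subrr.
  exists (e1 + kap b d0); rewrite !kapDr (eps_zero c') addr0 ue1; split=> //.
  by rewrite f'b -ed0 addrCA subrr addr0.
have [|||w wP] := @mor_of_rel _ _ _ _ X_add X_rigid B' T
    (fun Z e z => kap a z = kap u e /\ kap f' z = kap v e) _ _ _ tot.
- by move=> Z Z' g e z [az fz]; rewrite -!kap_push az fz.
- by move=> Z e z e' z' [az fz] [az' fz']; rewrite !kapBr az fz az' fz'.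
- by move=> Z z; rewrite !kapr0 => -[]; apply: mono.
exists w; split.
  split; apply: (kap_faithful X_add X_rigid) => Z z; have [e [ae fe]] := tot Z z;
    by rewrite kM (wP _ _ _ (conj ae fe)).
move=> w' [w'a w'f]; apply: (kap_faithful X_add X_rigid) => Z z.
by apply: wP; rewrite -!kM w'a w'f.
Qed.

(** The functor of the pullback is the pushout of K(B) and K(D') under K(D), an
    extension of K(A) by K(D') where A is the kernel of y. *)
Lemma eps_pullback B D D' (y : mor B D) (f : mor D' D) : deflation eps y ->
  exists B' (y' : mor B' D') (f' : mor B' B),
    is_pullback y f y' f' /\ deflation eps y'.
Proof.
move=> [A [x c]]; have [p] := presentation_ex X_add A.
have [b0 [psi [xb0 eb0]]] := eps_lift c p.
have [|B' [a [b [c0 [c' ac0 xc0]]]]] :=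
    eps_extension X_add X_rigid (p := p) (psi := kap f psi).
  by move=> Z h hx; rewrite kap_push (eps_rel0 c eb0 hx) kapr0.
have [|f' [yf' fb0]] := eps_map_into X_add X_rigid c xb0 eb0 (t := f ∘ b) (tau := c0).
  by rewrite xc0 kM.
exists B', b, f'; split; last by exists A, a.
split=> // T u v fu.
have [|w [bw wc0]] := eps_map_into X_add X_rigid c' ac0 xc0 (t := u) (tau := kap v b0).
  by rewrite kap_push eb0 -!kM fu.
have gen Z (e : EM B Z) : exists d0 (g : @mor C _ (sval Z)), e = kap y d0 + push E g b0.
  exact: (eps_gen X_add X_rigid c xb0).
exists w; split.
  split=> //; apply: (kap_faithful X_add X_rigid) => Z e.
  have [d0 [g ->]] := gen Z e.
  rewrite !kapDr -!kM -!kap_push (kM f' w) fb0 wc0; congr (_ + _).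
  by rewrite mcompA yf' -mcompA bw fu.
move=> w' [bw' fw']; apply: (kap_faithful X_add X_rigid) => Z e.
have [d0 [g ->]] := eps_gen X_add X_rigid c' ac0 e.
by rewrite !kapDr -!kM bw bw' -!kap_push wc0 -fw' kM fb0.
Qed.

Theorem M2_exact : exact_category eps.
Proof.
have [[O O0] _] := M2_additive.
split.
- exact: M2_additive.
- exact: (eps_is_kernel X_add X_rigid).
- exact: (eps_is_cokernel X_add X_rigid).
- exact: eps_isoclosed.
- by move=> A; exists O, 0; apply: eps_id0.
- by move=> A; exists O, 0; apply: eps_0id.
- exact: eps_infl_comp.
- exact: eps_defl_comp.
- exact: eps_pushout.
exact: eps_pullback.
Qed.

(** * Split monomorphisms of M2 *)

Hypothesis enough_inj : enough_injectives C.
Hypothesis X_inj : forall I, E_injective I -> X I.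

Lemma cls_eq0 M N (f : @mor C (sval M) (sval N)) :
  cls f = 0 :> mor M N -> exists Y (g : mor Y (sval N)) (h : mor (sval M) Y),
    X Y /\ f = g ∘ h.
Proof.
move=> /(@qcls_eq0 (Xn1 X n)); rewrite factor_idealP.
- by move=> [Y [g [h [XY e]]]]; exists (sval Y), g, h.
- have [[Z Z0] _] := addC; have XZ := addc_zero addC X_add Z0.
  have wZ : wedge (econf C) X n.+1 Z by apply/(resdim_leP X_add)/resdim_le0.
  by exists (exist _ Z wZ); split=> // A; apply: (Z0 (sval A)).
move=> A B XA XB; have [S [i1 [i2 [p1 [p2 bp]]]]] := addC.2 (sval A) (sval B).
have XS := addc_biprod addC X_add bp XA XB.
have wS : wedge (econf C) X n.+1 S by apply/(resdim_leP X_add)/resdim_le0.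
by exists (exist _ S wS), i1, i2, p1, p2; split=> //; case: bp.
Qed.

Lemma clsN M N (f : @mor C (sval M) (sval N)) : cls (- f) = - cls f :> mor M N.
Proof.
apply: (addrI (cls f)); rewrite -clsD !subrr.
exact: (@qcls0 (Xn1 X n)).
Qed.

(** A split monomorphism [cls a] of M2 lifts to a split inflation of C once the
    target is enlarged: if r ∘ a = 1 + h ∘ g with g : K -> X0 and X0 in X, then
    (r, -h, 0) is a retraction of (a, g, i) for any inflation i : K -> I into an
    injective. *)
Lemma split_mono_complement (K M : M2) (a : @mor C (sval K) (sval M))
    (r : @mor C (sval M) (sval K)) : cls r ∘ cls a = idm K ->
  exists (X0 I : C) (S N' : M2)
    (iM : @mor C (sval M) (sval S)) (iX : mor X0 (sval S)) (iI : mor I (sval S))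
    (pM : @mor C (sval S) (sval M)) (pX : mor (sval S) X0) (pI : mor (sval S) I)
    (f : mor (sval K) X0) (i : mor (sval K) I) (b' : @mor C (sval S) (sval N'))
    (j : @mor C (sval N') (sval S)),
    [/\ X X0, E_injective I, biprod3 iM iX iI pM pX pI,
        real (0 : EE C (sval N') (sval K)) (iM ∘ a + iX ∘ f + iI ∘ i) b'
      & biprod (cls a : mor K M) (cls pM ∘ cls j : mor N' M) (cls r)
          (cls b' ∘ cls iM)].
Proof.
move=> ra; have [|X0 [h [g [XX0 rah]]]] := @cls_eq0 K K (r ∘ a - idm _).
  by rewrite clsD clsN clsM ra subrr.
have [I [i [injI [Q [q [e ti]]]]]] := enough_inj (sval K).
have [[Z Z0] bps] := addC.
have [W [jM [jX [qM [qX bW]]]]] := bps (sval M) X0.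
have [S [iI [iW [pI [pW bS]]]]] := bps I W.
have ii : inflation (econf C) i by exists Q, q, e.
have iZ : inflation (econf C) (0 : mor Z W) by exists W, (idm W), 0; apply: real_0id.
have := infl_triangular (jM ∘ a + jX ∘ g) (biprod_zero (sval K) Z0) bS ii iZ.
rewrite !mcompE => -[N [b' [d t]]].
set x := _ + _ in t.
pose r' := r ∘ qM ∘ pW - h ∘ qX ∘ pW.
have bE := (biprodE bW, biprodE bS).
have r'x : r' ∘ x = idm (sval K).
  by rewrite /r' /x !(mcompE, bE) -rah opprB addrCA subrr addr0.
have [d0 [j bN]] := real_retraction t r'x; rewrite {d}d0 in t.
have hX Y : X Y -> resdim_le X n.+1 Y by apply: resdim_le0.
have hS : resdim_le X n.+1 S.
  apply: (resdim_le_biprod X_add bS); first exact/hX/X_inj.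
  apply: (resdim_le_biprod X_add bW); last exact: hX.
  exact/(resdim_leP X_add)/(svalP M).
have hN : resdim_le X n.+1 N.
  exact: (resdim_le_summand X_add X_rigid (leqnn _) (biprodC bN) hS).
pose S2 : M2 := exist _ S ((resdim_leP X_add _ _).2 hS).
pose N2 : M2 := exist _ N ((resdim_leP X_add _ _).2 hN).
pose iM : @mor C (sval M) (sval S2) := iW ∘ jM.
pose pM : @mor C (sval S2) (sval M) := qM ∘ pW.
have sumS : iM ∘ pM + iW ∘ jX ∘ (qX ∘ pW) + iI ∘ pI = idm S.
  have -> : iM ∘ pM + iW ∘ jX ∘ (qX ∘ pW) = iW ∘ (jM ∘ qM + jX ∘ qX) ∘ pW.
    by rewrite /iM /pM !mcompE.
  by rewrite (biprod_sum bW) mcompm1 addrC (biprod_sum bS).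
have pi1 : cls pM ∘ cls iM = idm M.
  by rewrite -clsM /pM /iM !(mcompE, bE).
have ip1 : cls iM ∘ cls pM = idm S2.
  rewrite -clsM; have := congr1 (@cls C X n S2 S2) sumS.
  have z1 : @cls C X n S2 S2 (iW ∘ jX ∘ (qX ∘ pW)) = 0.
    exact: (@cls_factor _ _ _ X_add S2 S2 X0).
  have z2 : @cls C X n S2 S2 (iI ∘ pI) = 0.
    exact: (@cls_factor _ _ _ X_add S2 S2 I _ _ (X_inj injI)).
  by rewrite !clsD z1 z2 !addr0.
have bM : @biprod M2 K N2 S2 (@cls C X n K S2 x) (@cls C X n N2 S2 j)
    (@cls C X n S2 K r') (@cls C X n S2 N2 b').
  by apply: (@quotcat_biprod (Xn1 X n)); case: bN.
have {}bM := biprod_iso ip1 pi1 bM.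
exists X0, I, S2, N2, iM, (iW ∘ jX), iI, pM, (qX ∘ pW), pI, g, i, b', j; split=> //.
- by split; [|split; [|split]]; rewrite ?sumS //; split; rewrite /iM /pM !(mcompE, bE).
- by move: t; rewrite /x /iM addrC.
move: bM; rewrite -!clsM.
have -> : pM ∘ x = a by rewrite /pM /x !(mcompE, bE).
by have -> : r' ∘ iM = r by rewrite /r' /iM !(mcompE, bE).
Qed.

Theorem M2_weakly_idempotent_complete : weakly_idempotent_complete M2.
Proof.
move=> A B f s fs; have [[r er] [a ea]] := (cls_surj f, cls_surj s).
rewrite er ea in fs *; have [X0 [I [S [N [iM [iX [iI [pM [pX [pI [g [i [b [j [_ _ _ _ bp]]]]]]]]]]]]]]]
  := split_mono_complement fs.
by exists N, (cls pM ∘ cls j); apply: biprod_kernel (biprodC bp).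
Qed.

Lemma Kob_fmap M Z Z' (g : @mor C (sval Z) (sval Z')) (e : EM M Z) :
  fmap (Kob M) (qcls (inj_ideal X n) (g : @mor (Defs.Xn X n) Z Z')) e = push E g e.
Proof. exact: (induced_mapE (@Ecov_inj C X n (sval M))). Qed.

(** The triangle pK -> pY -> M gives the presentation of the functor of M by
    representable functors on the quotient category. *)
Lemma in_L_Kob M : in_L (Kob M).
Proof.
have [p] := presentation_ex X_add M.
pose q Z Z' (g : @mor C (sval Z) (sval Z')) : @mor Xn Z Z' :=
  qcls (inj_ideal X n) (g : @mor (Defs.Xn X n) Z Z').
have q_surj Z Z' (g : @mor Xn Z Z') : exists g', g = q _ _ g'.
  by exists (qrepr g); rewrite /q qreprK.
have qM U V W (g : @mor C (sval V) (sval W)) (f : @mor C (sval U) (sval V)) :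
  q _ _ (g ∘ f) = q _ _ g ∘ q _ _ f by exact: (esym (qcompE _ _ _)).
unshelve refine (ex_intro _ (pY p) (ex_intro _ (pK p)
  (ex_intro _ (@Nattrans _ (yoneda (pY p)) (yoneda (pK p))
     (fun Z f => f ∘ q _ _ (px p)) _ _)
  (ex_intro _ (@Nattrans _ (yoneda (pK p)) (Kob M)
     (fun Z f => fmap (Kob M) f (pd p)) _ _) _)))).
- by move=> Z f g; rewrite mcompDl.
- by move=> Z Z' g f /=; rewrite [RHS](@mcompA Xn).
- by move=> Z f g; rewrite [LHS]fmapDl.
- by move=> Z Z' g f; rewrite [LHS]fmapM.
split; first exact: pY_X.
- move=> Z f; have [g ->] := q_surj _ _ f; split.
    move=> /(etrans (esym (Kob_fmap g (pd p)))) /pres_rel [h ->].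
    by exists (q _ _ h); apply: qM.
  move=> [u eu]; have [h eh] := q_surj _ _ u.
  have -> : q _ _ g = q _ _ (h ∘ px p) by rewrite eu eh qM.
  by apply: etrans (Kob_fmap _ _) _; rewrite pushM pres_push0 pushr0.
move=> Z e; have [g ->] := pres_gen X_add X_rigid p e.
by exists (q _ _ g); apply: esym (Kob_fmap g (pd p)).
Qed.

End ExactAxioms.

(** * The theorem *)

Theorem theorem4p2 (C : extriangulated) (H : higher_extensions C)
    (n : nat) (X : C -> Prop)
    (enough_inj : enough_injectives C)
    (X_add : forall A, X A <-> addc X A)
    (X_rigid : rigid H n.+2 X)
    (X_inj : forall I, E_injective I -> X I) :
  let M2 := M2 X n in
  let eps2 : conf_class M2 := @eps_K C X n in
  let epsM2 := confcat eps2 in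
  let SM2 : epsM2 -> Prop := @split_conflation M2 eps2 in
  [/\ exact_category eps2 /\ weakly_idempotent_complete M2,
      (* (a) *)
      pseudo_cluster_tilting (degreewise (conf := eps2)) SM2 /\
      (forall eta : epsM2, wedge (degreewise (conf := eps2)) SM2 1 eta /\
                           vee (degreewise (conf := eps2)) SM2 1 eta),
      (* (b) *)
      abelian_cat (quotcat (factor_ideal SM2))
    & (* (c) *)
      forall (K M N : M2) (a : @mor C (sval K) (sval M)) (b : @mor C (sval M) (sval N))
        (eta : eps2 K M N (cls a) (cls b)),
        SM2 (Confob eta) <->
        exists (X0 I : C) (S N' : M2)
          (iM : @mor C (sval M) (sval S)) (iX : mor X0 (sval S)) (iI : mor I (sval S))
          (pM : @mor C (sval S) (sval M)) (pX : mor (sval S) X0) (pI : mor (sval S) I)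
          (f : mor (sval K) X0) (i : mor (sval K) I)
          (b' : @mor C (sval S) (sval N'))
          (phi : nattrans (Kob N') (Kob N)),
          (* S is M (+) X0 (+) I; [Kmor (cls iM)] identifies K(S) with K(M) *)
          [/\ X X0, E_injective I, biprod3 iM iX iI pM pX pI
            & real (0 : EE C (sval N') (sval K)) (iM ∘ a + iX ∘ f + iI ∘ i) b'] /\
          [/\ L_conflation (nt_comp (Kmor (cls iM)) (Kmor (cls b'))) (Kmor (cls a)),
              L_conflation (Kmor (cls b)) (Kmor (cls a)),
              nt_iso phi
            & forall Y (x : Kob N' Y),
                ntf (Kmor (cls b)) (ntf phi x) =
                ntf (nt_comp (Kmor (cls iM)) (Kmor (cls b'))) x]].
Proof.
move=> M2' eps2' epsM2 SM2; rewrite {}/SM2 {}/epsM2 {}/eps2' {}/M2'.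
have ex := M2_exact X_add X_rigid.
split.
- split=> //; exact: M2_weakly_idempotent_complete X_add X_rigid enough_inj X_inj.
- have pct := split_pseudo_cluster_tilting ex.
  by split=> // eta; apply: pseudo_cluster_tilting_resolutions pct eta.
- exact: stable_abelian.
move=> K M N a b eta; split.
  move=> [s [r /biprod_p1i1 /= ra]].
  have [r' er] := cls_surj r; rewrite er in ra.
  have [X0 [I [S [N' [iM [iX [iI [pM [pX [pI [f [i [b' [j [XX0 injI bp3 t bp]]]]]]]]]]]]]]]
    := split_mono_complement X_add X_rigid enough_inj X_inj ra.
  have c' := conf_split ex bp.
  have L M1 : in_L (Kob M1) := in_L_Kob X_add X_rigid M1.
  have Lb' : L_conflation (nt_comp (Kmor (cls iM)) (Kmor (cls b'))) (Kmor (cls a)).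
    split=> //; have E1 Z e : ntf (nt_comp (Kmor (cls iM)) (Kmor (cls b'))) e =
        ntf (Kmor (cls b' ∘ cls iM)) e :> Kob M Z.
      exact: (esym (kapM X_rigid _ _ _)).
    case: c' => inj exa sur; split=> //.
      by move=> Z e; rewrite E1; apply: inj.
    move=> Z e; split=> [/(exa Z) [u ->]|[u ->]]; first by exists u; rewrite E1.
    by apply/(exa Z); exists u; rewrite E1.
  have Lb : L_conflation (Kmor (cls b)) (Kmor (cls a)) by split.
  have [_ _ _ seb'] := Lb'; have [phi [phi_iso phiP]] := kernel_iso eta seb'.
  by exists X0, I, S, N', iM, iX, iI, pM, pX, pI, f, i, b', phi.
move=> [X0 [I [S [N' [iM [iX [iI [pM [pX [pI [f [i [b' [phi [[XX0 injI bp3 t] _]]]]]]]]]]]]]]].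
have [|r rx] := real_colift_push t (g := idm (sval K)); first exact: pushr0.
apply: (@split_of_retraction _ _ ex (Confob eta) (cls (r ∘ iM) : mor M K)).
have zX : @cls C X n K K (r ∘ iX ∘ f) = 0 by apply: cls_factor.
have zI : @cls C X n K K (r ∘ iI ∘ i) = 0 by apply: cls_factor => //; apply: X_inj.
rewrite /= -[RHS]/(@cls C X n K K (idm (sval K))) -rx !mcompDr !mcompA !clsD.
by rewrite zX zI !addr0; apply: esym (clsM _ _).
Qed.
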